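(* Let $\mathcal K$ be a 2-category and $n$ a positive integer. For each $1\le m\le n$ and $1\le k\le m$ let $C_k^{(m)}:\mathsf{Wdl}^{(m)}(\overline{\mathcal K})\to\mathsf{Wdl}^{(m-1)}(\overline{\mathcal K})$ be the 2-functor $C_k$ described in the context. Then the composite 2-functor $$C^{(1)}_{k_1}\circ C^{(2)}_{k_2}\circ\cdots\circ C^{(n)}_{k_n}:\mathsf{Wdl}^{(n)}(\overline{\mathcal K})\to\mathsf{Wdl}^{(0)}(\overline{\mathcal K})=\mathsf{Mnd}(\overline{\mathcal K})$$ does not depend on the choice of the indices $k_i\in\{1,2,\dots,i\}$, $1\le i\le n$.
   Context: Conventions. For 1-cells, $uw$ is the horizontal composite ($w$ applied first); for 2-cells $\alpha,\beta$, $\alpha\beta$ is their horizontal composite; a 1-cell written next to a 2-cell means whiskering by its identity 2-cell; $\alpha.\beta$ is vertical composition ($\beta$ first). A monad $(A,t)$ has multiplication $\mu:tt\to t$ and unit $\eta:1_A\to t$; decorations of $t$ (indices, primes) carry over to $\mu,\eta$. Local idempotent closure $\overline{\mathcal K}$: same 0-cells as $\mathcal K$; 1-cells $A\to B$ are pairs $(v,\bar v)$ with $v:A\to B$ a 1-cell of $\mathcal K$ and $\bar v:v\to v$ an idempotent 2-cell; 2-cells $(v,\bar v)\to(v',\bar v')$ are 2-cells $\omega:v\to v'$ of $\mathcal K$ with $\bar v'.\omega=\omega=\omega.\bar v$; compositions are induced from $\mathcal K$ (horizontal composite of $(u,\bar u),(w,\bar w)$ is $(uw,\bar u\bar w)$),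 the identity 2-cell of $(v,\bar v)$ is $\bar v$. A monad $(A,(t,\bar t))$ in $\overline{\mathcal K}$ is given by 2-cells $\mu,\eta$ of $\mathcal K$ satisfying the monad axioms in $\overline{\mathcal K}$ (so $\mu.t\eta=\mu.\eta t=\bar t$); we often write just $t$, and write $v$ for $(v,\bar v)$. For $\mathcal L\in\{\mathcal K,\overline{\mathcal K}\}$, $\mathsf{Mnd}(\mathcal L)$ has as 0-cells the monads $(A,t)$ in $\mathcal L$; 1-cells $(A,t)\to(A',t')$ are pairs $(v,\psi)$ with $v:A\to A'$ and $\psi:t'v\to vt$ in $\mathcal L$, $\psi.\mu'v=v\mu.\psi t.t'\psi$, $\psi.\eta'v=v\eta$; 2-cells $(v,\psi)\to(v',\psi')$ are $\omega:v\to v'$ with $\psi'.t'\omega=\omega t.\psi$; the composite of $(u,\chi)$ followed by $(v,\psi)$ is $(vu,v\chi.\psi u)$. A weak distributive law in $\mathcal L$: monads $(A,t),(A,s)$ in $\mathcal L$ and a 2-cell $\lambda:ts\to st$ of $\mathcal L$ with $\lambda.\mu s=s\mu.\lambda t.t\lambda$, $\lambda.t\mu=\mu t.s\lambda.\lambda s$, $\lambda.\eta s=\mu t.s\lambda.st\eta.s\eta$, $\lambda.t\eta=s\mu.\lambda t.\eta st.\eta t$. Its idempotent is $\bar\lambda:=\mu t.s\lambda.st\eta=s\mu.\lambda t.\eta st$. For $\lambda$ in $\overline{\mathcal K}$ its weak wreath product is the monad $(A,(st,\bar\lambda))$ in $\overline{\mathcal K}$ with multiplication $\mu\mu.s\lambda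 t$ and unit $\lambda.\eta\eta$. $\mathsf{Wdl}(\mathcal L)$: 0-cells are weak distributive laws in $\mathcal L$; a 1-cell from $\lambda:ts\to st$ (on $A$) to $\lambda':t's'\to s't'$ (on $A'$) is $(v,\xi,\zeta)$ with $(v,\xi):(A,t)\to(A',t')$, $(v,\zeta):(A,s)\to(A',s')$ 1-cells of $\mathsf{Mnd}(\mathcal L)$ and $v\lambda.\xi s.t'\zeta=v\bar\lambda.\zeta t.s'\xi.\lambda'v$; 2-cells are 2-cells $\omega$ of $\mathcal L$ that are 2-cells of $\mathsf{Mnd}(\mathcal L)$ both $(v,\xi)\to(v',\xi')$ and $(v,\zeta)\to(v',\zeta')$. $\mathsf{Wdl}^{(n)}(\mathcal L)$ ($n\ge0$): a 0-cell consists of monads $(A,s_0),\dots,(A,s_n)$ in $\mathcal L$ on one object and weak distributive laws $\lambda_{i,j}:s_js_i\to s_is_j$ ($0\le i<j\le n$) satisfying the Yang–Baxter relation $\lambda_{i,j}s_k.s_j\lambda_{i,k}.\lambda_{j,k}s_i=s_i\lambda_{j,k}.\lambda_{i,k}s_j.s_k\lambda_{i,j}$ for $i<j<k$. A 1-cell to $\{\lambda'_{i,j}:s'_js'_i\to s'_is'_j\}$ (on $A'$) is $v:A\to A'$ with 2-cells $\xi_i:s'_iv\to vs_i$ such that each $(v,\xi_i)$ is a 1-cell of $\mathsf{Mnd}(\mathcal L)$ and each $(v,\xi_i,\xi_j)$, $i<j$, is a 1-cell $\lambda_{i,j}\to\lambda'_{i,j}$ of $\mathsf{Wdl}(\mathcal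 L)$; 2-cells are $\omega:v\to v'$ which are 2-cells $(v,\xi_i)\to(v',\xi'_i)$ of $\mathsf{Mnd}(\mathcal L)$ for all $i$; compositions come from $\mathcal L$. So $\mathsf{Wdl}^{(0)}(\mathcal L)=\mathsf{Mnd}(\mathcal L)$, $\mathsf{Wdl}^{(1)}(\mathcal L)=\mathsf{Wdl}(\mathcal L)$. $\bar\lambda_{ij}$ denotes the idempotent of $\lambda_{i,j}$. The 2-functor $C_k:\mathsf{Wdl}^{(m)}(\overline{\mathcal K})\to\mathsf{Wdl}^{(m-1)}(\overline{\mathcal K})$ ($1\le k\le m$): it sends a 0-cell $\{\lambda_{i,j}\}$ to the 0-cell whose monads are $s_0,\dots,s_{k-2}$, the weak wreath product $(s_{k-1}s_k,\bar\lambda_{k-1,k})$, $s_{k+1},\dots,s_m$ (in this order), with weak distributive laws: $\lambda_{i,j}$ if $i,j\notin\{k-1,k\}$; $s_{k-1}\lambda_{k,j}.\lambda_{k-1,j}s_k.s_j\bar\lambda_{k-1,k}:s_j(s_{k-1}s_k)\to(s_{k-1}s_k)s_j$ for $j>k$; $\lambda_{i,k-1}s_k.s_{k-1}\lambda_{i,k}.\bar\lambda_{k-1,k}s_i:(s_{k-1}s_k)s_i\to s_i(s_{k-1}s_k)$ for $i<k-1$. It sends a 1-cell $(v,\{\xi_i\})$ to $v$ with the 2-cells $\xi_i$ ($i<k-1$), $v\bar\lambda_{k-1,k}.\xi_{k-1}s_k.s'_{k-1}\xi_k$, and $\xi_{i}$ ($i>k$), in this order; it is the identity on 2-cells. *)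

(* Defs.v *)
From mathcomp Require Import all_boot.


(* Strict 2-categories, in single-sorted presentation: 2-cells between       *)
(* parallel 1-cells A -> B form one type [Cell A B] equipped with source and *)
(* target 1-cells.  Vertical composition [vcomp a b] (= a.b, b first) is a    *)
(* total operation whose axioms are only imposed on composable pairs.        *)
(* Horizontal composition [hcomp a b] (= ab, b applied first) and            *)
(* composition of 1-cells [comp1 u w] (= uw, w first).                        *)
Record TwoCat := {
  Obj : Type;
  Hom : Obj -> Obj -> Type;
  Cell : Obj -> Obj -> Type;
  id1 : forall A, Hom A A;
  comp1 : forall A B C, Hom B C -> Hom A B -> Hom A C;
  src : forall A B, Cell A B -> Hom A B;
  tgt : forall A B, Cell A B -> Hom A B;
  id2 : forall A B, Hom A B -> Cell A B;
  vcomp : forall A B, Cell A B -> Cell A B -> Cell A B;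
  hcomp : forall A B C, Cell B C -> Cell A B -> Cell A C;
  comp1A : forall A B C D (u : Hom C D) (v : Hom B C) (w : Hom A B),
    comp1 _ _ _ u (comp1 _ _ _ v w) = comp1 _ _ _ (comp1 _ _ _ u v) w;
  comp1_id1l : forall A B (u : Hom A B), comp1 _ _ _ (id1 B) u = u;
  comp1_id1r : forall A B (u : Hom A B), comp1 _ _ _ u (id1 A) = u;
  src_id2 : forall A B (u : Hom A B), src _ _ (id2 _ _ u) = u;
  tgt_id2 : forall A B (u : Hom A B), tgt _ _ (id2 _ _ u) = u;
  src_vcomp : forall A B (a b : Cell A B),
    tgt _ _ b = src _ _ a -> src _ _ (vcomp _ _ a b) = src _ _ b;
  tgt_vcomp : forall A B (a b : Cell A B),
    tgt _ _ b = src _ _ a -> tgt _ _ (vcomp _ _ a b) = tgt _ _ a;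
  src_hcomp : forall A B C (a : Cell B C) (b : Cell A B),
    src _ _ (hcomp _ _ _ a b) = comp1 _ _ _ (src _ _ a) (src _ _ b);
  tgt_hcomp : forall A B C (a : Cell B C) (b : Cell A B),
    tgt _ _ (hcomp _ _ _ a b) = comp1 _ _ _ (tgt _ _ a) (tgt _ _ b);
  vcompA : forall A B (a b c : Cell A B),
    tgt _ _ c = src _ _ b -> tgt _ _ b = src _ _ a ->
    vcomp _ _ a (vcomp _ _ b c) = vcomp _ _ (vcomp _ _ a b) c;
  vcomp_id2l : forall A B (a : Cell A B), vcomp _ _ (id2 _ _ (tgt _ _ a)) a = a;
  vcomp_id2r : forall A B (a : Cell A B), vcomp _ _ a (id2 _ _ (src _ _ a)) = a;
  hcompA : forall A B C D (a : Cell C D) (b : Cell B C) (c : Cell A B),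
    hcomp _ _ _ a (hcomp _ _ _ b c) = hcomp _ _ _ (hcomp _ _ _ a b) c;
  hcomp_id1l : forall A B (a : Cell A B), hcomp _ _ _ (id2 _ _ (id1 B)) a = a;
  hcomp_id1r : forall A B (a : Cell A B), hcomp _ _ _ a (id2 _ _ (id1 A)) = a;
  hcomp_id2 : forall A B C (u : Hom B C) (w : Hom A B),
    hcomp _ _ _ (id2 _ _ u) (id2 _ _ w) = id2 _ _ (comp1 _ _ _ u w);
  interchange : forall A B C (a b : Cell B C) (c d : Cell A B),
    tgt _ _ b = src _ _ a -> tgt _ _ d = src _ _ c ->
    hcomp _ _ _ (vcomp _ _ a b) (vcomp _ _ c d)
    = vcomp _ _ (hcomp _ _ _ a c) (hcomp _ _ _ b d)
}.

Set Implicit Arguments.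
Unset Strict Implicit.
Unset Printing Implicit Defensive.

Arguments Hom {K} A B : rename.
Arguments Cell {K} A B : rename.
Arguments id1 {K} A : rename.
Arguments comp1 {K A B C} u w : rename.
Arguments src {K A B} a : rename.
Arguments tgt {K A B} a : rename.
Arguments id2 {K A B} u : rename.
Arguments vcomp {K A B} a b : rename.
Arguments hcomp {K A B C} a b : rename.

Section LocalIdempotentClosure.
Variable K : TwoCat.

(* (v, vb) is a 1-cell of the local idempotent closure: vb : v -> v idempotent *)
Definition idem {A B : Obj K} (v : Hom A B) (vb : Cell A B) : Prop :=
  [/\ src vb = v, tgt vb = v & vcomp vb vb = vb].

(* w is a 2-cell (u, ub) -> (u', ub') of the local idempotent closure *)
Definition bcell {A B : Obj K} (u : Hom A B) (ub : Cell A B)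
  (u' : Hom A B) (ub' : Cell A B) (w : Cell A B) : Prop :=
  [/\ src w = u, tgt w = u', vcomp ub' w = w & vcomp w ub = w].

Record bmonad (A : Obj K) := BMonad {
  mt : Hom A A; mtb : Cell A A; mmu : Cell A A; meta : Cell A A }.

(* Monad axioms in the local idempotent closure (whiskering by t means
   horizontal composition with its identity 2-cell tb there). *)
Definition is_bmonad {A : Obj K} (M : bmonad A) : Prop :=
  let t := mt M in let tb := mtb M in let mu := mmu M in let eta := meta M in
  [/\ idem t tb,
      bcell (comp1 t t) (hcomp tb tb) t tb mu,
      bcell (id1 A) (id2 (id1 A)) t tb eta,
      vcomp mu (hcomp mu tb) = vcomp mu (hcomp tb mu) &
      vcomp mu (hcomp tb eta) = tb /\ vcomp mu (hcomp eta tb) = tb].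

Definition is_wdl {A : Obj K} (T S : bmonad A) (l : Cell A A) : Prop :=
  let t := mt T in let tb := mtb T in let mut := mmu T in let etat := meta T in
  let s := mt S in let sb := mtb S in let mus := mmu S in let etas := meta S in
  [/\ bcell (comp1 t s) (hcomp tb sb) (comp1 s t) (hcomp sb tb) l,
      vcomp l (hcomp mut sb)
        = vcomp (hcomp sb mut) (vcomp (hcomp l tb) (hcomp tb l)),
      vcomp l (hcomp tb mus)
        = vcomp (hcomp mus tb) (vcomp (hcomp sb l) (hcomp l sb)),
      vcomp l (hcomp etat sb)
        = vcomp (hcomp mus tb) (vcomp (hcomp sb l)
            (vcomp (hcomp (hcomp sb tb) etas) (hcomp sb etat))) &
      vcomp l (hcomp tb etas)
        = vcomp (hcomp sb mut) (vcomp (hcomp l tb)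
            (vcomp (hcomp etat (hcomp sb tb)) (hcomp etas tb)))].

Definition lbar {A : Obj K} (T S : bmonad A) (l : Cell A A) : Cell A A :=
  vcomp (hcomp (mmu S) (mtb T))
        (vcomp (hcomp (mtb S) l) (hcomp (hcomp (mtb S) (mtb T)) (meta S))).

Definition wreath {A : Obj K} (T S : bmonad A) (l : Cell A A) : bmonad A :=
  BMonad (comp1 (mt S) (mt T)) (lbar T S l)
    (vcomp (hcomp (mmu S) (mmu T)) (hcomp (mtb S) (hcomp l (mtb T))))
    (vcomp l (hcomp (meta T) (meta S))).

(* Data of a 0-cell of Wdl^(n)(Kbar) on the object A: monads s_i and laws
   l i j : s_j s_i -> s_i s_j (only i <= n, resp. i < j <= n, are relevant). *)
Record wdl0 (A : Obj K) := WDL0 {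
  ws : nat -> bmonad A; wl : nat -> nat -> Cell A A }.

(* Data of a 1-cell X -> Y: (v, vb) and xi_i : s'_i v -> v s_i. *)
Record wdl1 (A B : Obj K) (X : wdl0 A) (Y : wdl0 B) := WDL1 {
  wv : Hom A B; wvb : Cell A B; wxi : nat -> Cell A B }.

Definition is_wdl0 (n : nat) {A : Obj K} (X : wdl0 A) : Prop :=
  let s := ws X in let l := wl X in
  [/\ forall i, i <= n -> is_bmonad (s i),
      forall i j, i < j -> j <= n -> is_wdl (s j) (s i) (l i j) &
      forall i j k, i < j -> j < k -> k <= n ->
        vcomp (hcomp (l i j) (mtb (s k)))
          (vcomp (hcomp (mtb (s j)) (l i k)) (hcomp (l j k) (mtb (s i))))
        = vcomp (hcomp (mtb (s i)) (l j k))
          (vcomp (hcomp (l i k) (mtb (s j))) (hcomp (mtb (s k)) (l i j)))].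

Definition is_mnd1 {A B : Obj K} (M : bmonad A) (M' : bmonad B)
  (v : Hom A B) (vb : Cell A B) (xi : Cell A B) : Prop :=
  [/\ bcell (comp1 (mt M') v) (hcomp (mtb M') vb)
            (comp1 v (mt M)) (hcomp vb (mtb M)) xi,
      vcomp xi (hcomp (mmu M') vb)
        = vcomp (hcomp vb (mmu M)) (vcomp (hcomp xi (mtb M)) (hcomp (mtb M') xi)) &
      vcomp xi (hcomp (meta M') vb) = hcomp vb (meta M)].

Definition is_wdl1 (n : nat) {A B : Obj K} {X : wdl0 A} {Y : wdl0 B}
  (F : wdl1 X Y) : Prop :=
  let s := ws X in let l := wl X in let s' := ws Y in let l' := wl Y in
  let v := wv F in let vb := wvb F in let xi := wxi F in
  [/\ idem v vb,
      forall i, i <= n -> is_mnd1 (s i) (s' i) v vb (xi i) &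
      forall i j, i < j -> j <= n ->
        vcomp (hcomp vb (l i j))
          (vcomp (hcomp (xi j) (mtb (s i))) (hcomp (mtb (s' j)) (xi i)))
        = vcomp (hcomp vb (lbar (s j) (s i) (l i j)))
          (vcomp (hcomp (xi i) (mtb (s j)))
            (vcomp (hcomp (mtb (s' i)) (xi j)) (hcomp (l' i j) vb)))].

(* old index of the new index i /= k-1 under C_k *)
Definition oldi (k i : nat) : nat := if i < k.-1 then i else i.+1.

Definition Ck0 (k : nat) {A : Obj K} (X : wdl0 A) : wdl0 A :=
  let s := ws X in let l := wl X in
  let lb := lbar (s k) (s k.-1) (l k.-1 k) in
  WDL0
    (fun i => if i < k.-1 then s i
              else if i == k.-1 then wreath (s k) (s k.-1) (l k.-1 k)
              else s i.+1)
    (fun i j =>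
       if i == k.-1 then
         vcomp (hcomp (mtb (s k.-1)) (l k (oldi k j)))
           (vcomp (hcomp (l k.-1 (oldi k j)) (mtb (s k)))
                  (hcomp (mtb (s (oldi k j))) lb))
       else if j == k.-1 then
         vcomp (hcomp (l i k.-1) (mtb (s k)))
           (vcomp (hcomp (mtb (s k.-1)) (l i k)) (hcomp lb (mtb (s i))))
       else l (oldi k i) (oldi k j)).

(* The 2-functor C_k on 1-cells (identity on 2-cells) *)
Definition Ck1 (k : nat) {A B : Obj K} {X : wdl0 A} {Y : wdl0 B}
  (F : wdl1 X Y) : wdl1 (Ck0 k X) (Ck0 k Y) :=
  let s := ws X in let l := wl X in let s' := ws Y in
  let xi := wxi F in let vb := wvb F in
  @WDL1 A B (Ck0 k X) (Ck0 k Y) (wv F) vb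
    (fun i => if i < k.-1 then xi i
              else if i == k.-1 then
                vcomp (hcomp vb (lbar (s k) (s k.-1) (l k.-1 k)))
                  (vcomp (hcomp (xi k.-1) (mtb (s k))) (hcomp (mtb (s' k.-1)) (xi k)))
              else xi i.+1).

Fixpoint Ccomp0 (ks : nat -> nat) (n : nat) {A : Obj K} (X : wdl0 A) : wdl0 A :=
  match n with
  | 0 => X
  | m.+1 => Ccomp0 ks m (Ck0 (ks m.+1) X)
  end.

Fixpoint Ccomp1 (ks : nat -> nat) (n : nat) {A B : Obj K} {X : wdl0 A}
  {Y : wdl0 B} (F : wdl1 X Y) : wdl1 (Ccomp0 ks n X) (Ccomp0 ks n Y) :=
  match n return wdl1 (Ccomp0 ks n X) (Ccomp0 ks n Y) with
  | 0 => F
  | m.+1 => Ccomp1 ks m (Ck1 (ks m.+1) F)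
  end.

End LocalIdempotentClosure.

(* Main.v *)
Require Import Defs.
From HB Require Import structures.
From mathcomp Require Import all_boot.

(** By induction on n, every composite equals the one with all indices 1.  The
    induction step rests on two identities: C_1 C_k = C_{k-1} C_1 for k >= 3,
    and C_1 C_2 = C_1 C_1, that is, associativity of the weak wreath product.
    These, and the fact that C_k preserves 0-cells and 1-cells, involve at most
    four monads at a time and reduce to equations between string diagrams in
    the local idempotent closure.  Such an equation is proved by rewriting with
    the axioms of weak distributive laws modulo interchange, and the sequence
    of rewriting steps is verified by computation. *)

Set Implicit Arguments.
Unset Strict Implicit.
Unset Printing Implicit Defensive.

(** [C_k] is the identity on 2-cells, so only the values on 0-cells and 1-cells have to be compared.
    The induction hypothesis is applied twice, to two different index sequences: once below the
    given top index, and once, after a single [C_1], to a sequence chosen so that the commutation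
    identity applies.

    Two disjoint merges do not commute formally: the law between two weak wreath products arises
    from two different formulas, and these agree only through the Yang-Baxter relation. This law,
    and the Yang-Baxter relations that involve a product, are where four monads meet.

    The obstacle is weakness. Unit axioms leave idempotents behind, which must be expanded, carried
    through other crossings and absorbed again, with interchange used at every turn. Hence the
    equations are left to a reflexive checker, which trusts neither its search for occurrences nor
    the normal form of a diagram: only soundness of each step is proved. The checker knows one
    object; a 1-cell between two objects reaches it through an auxiliary 2-category. *)

Section ClosureCells.
Variable K : TwoCat.

(** * Compositions in the local idempotent closure *)

Lemma bcell_id A B (u : @Hom K A B) ub : idem u ub -> bcell u ub u ub ub.
Proof. by case. Qed.

Lemma bcell_vcomp A B (u u' u'' : @Hom K A B) ub ub' ub'' a b :
  bcell u' ub' u'' ub'' a -> bcell u ub u' ub' b ->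
  idem u ub -> idem u'' ub'' -> bcell u ub u'' ub'' (vcomp a b).
Proof.
case=> sa ta a1 a2 [sb tb b1 b2] [su tu _] [su'' tu'' _].
have tbsa : tgt b = src a by rewrite tb sa.
by split; rewrite ?src_vcomp ?tgt_vcomp // ?vcompA ?a1 -?vcompA ?b2 ?ta ?su'' ?tu ?sb.
Qed.

Lemma bcell_hcomp A B C (u u' : @Hom K B C) ub ub' (w w' : @Hom K A B) wb wb' a b :
  bcell u ub u' ub' a -> bcell w wb w' wb' b ->
  idem u ub -> idem u' ub' -> idem w wb -> idem w' wb' ->
  bcell (comp1 u w) (hcomp ub wb) (comp1 u' w') (hcomp ub' wb') (hcomp a b).
Proof.
case=> sa ta a1 a2 [sb tb b1 b2] [su tu _] [su' tu' _] [sw tw _] [sw' tw' _].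
by split; rewrite ?src_hcomp ?tgt_hcomp ?sa ?ta ?sb ?tb // -Defs.interchange ?a1 ?a2
  ?b1 ?b2 // ?ta ?tb ?sa ?sb.
Qed.

Lemma idem_hcomp A B C (u : @Hom K B C) ub (w : @Hom K A B) wb :
  idem u ub -> idem w wb -> idem (comp1 u w) (hcomp ub wb).
Proof.
case=> su tu uu [sw tw ww].
by split; rewrite ?src_hcomp ?tgt_hcomp ?su ?tu ?sw ?tw // -Defs.interchange ?uu ?ww
  ?su ?tu ?sw ?tw.
Qed.

Lemma idem_id2 A B (u : @Hom K A B) : idem u (id2 u).
Proof.
by split; rewrite ?src_id2 ?tgt_id2 //; have := @vcomp_id2l K A B (id2 u); rewrite tgt_id2.
Qed.

End ClosureCells.

(** * Diagrams *)

(* [None] is the strand of the 1-cell v, [Some i] that of the monad s_i. *)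
Notation strand := (option nat).
Notation word := (seq strand).

Inductive gen := Mu of nat | Eta of nat | Law of nat & nat | Bar of nat & nat
  | Xi of nat.

Definition gen_code g : nat * nat * nat := match g with
  | Mu i => (0, i, 0) | Eta i => (1, i, 0) | Law i j => (2, i, j)
  | Bar i j => (3, i, j) | Xi i => (4, i, 0) end.

Definition gen_decode (c : nat * nat * nat) := match c with
  | (0, i, _) => Mu i | (1, i, _) => Eta i | (2, i, j) => Law i j
  | (3, i, j) => Bar i j | (_, i, _) => Xi i end.

Lemma gen_codeK : cancel gen_code gen_decode.
Proof. by case. Qed.

HB.instance Definition _ := Equality.copy gen (can_type gen_codeK).

(* The monads of the target of a 1-cell are stored with their indices raised
   by 4, since at most four monads occur together. *)
Definition gsrc g : word := match g with
  | Mu i => [:: Some i; Some i] | Eta i => [::]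
  | Law i j => [:: Some j; Some i] | Bar i j => [:: Some i; Some j]
  | Xi i => [:: Some (i + 4); None] end.

Definition gtgt g : word := match g with
  | Mu i | Eta i => [:: Some i]
  | Law i j | Bar i j => [:: Some i; Some j]
  | Xi i => [:: None; Some i] end.

(* [(p, g, q)] is the generator g whiskered by p and q; a diagram lists its
   layers in the order in which they are applied. *)
Definition layer := (word * gen * word)%type.
Definition lsrc (x : layer) : word := x.1.1 ++ gsrc x.1.2 ++ x.2.
Definition ltgt (x : layer) : word := x.1.1 ++ gtgt x.1.2 ++ x.2.

Definition whisk (p q : word) (d : seq layer) : seq layer :=
  [seq (p ++ x.1.1, x.1.2, x.2 ++ q) | x <- d].

Definition dtgt (w : word) (d : seq layer) : word := last w (map ltgt d).

(** Here [x] is applied before [y], and [y] lies to its left; [m] is the word of strands between the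
    two generators. *)
Definition swapl (x y : layer) : option (layer * layer) :=
  let: (p, c, q) := x in let: (p', c', q') := y in
  let m := drop (size p' + size (gsrc c')) p in
  if (p == p' ++ gsrc c' ++ m) && (q' == m ++ gtgt c ++ q)
  then Some ((p', c', m ++ gsrc c ++ q), (p' ++ gtgt c' ++ m, c, q)) else None.

Definition swapr (x y : layer) : option (layer * layer) :=
  let: (p, c, q) := x in let: (p', c', q') := y in
  let m := drop (size p + size (gtgt c)) p' in
  if (p' == p ++ gtgt c ++ m) && (q == m ++ gsrc c' ++ q')
  then Some ((p ++ gsrc c ++ m, c', q'), (p, c, m ++ gtgt c' ++ q')) else None.

Definition swap x y := if swapl x y is Some r then Some r else swapr x y.

Fixpoint insert (x : layer) (d : seq layer) : seq layer :=
  if d is y :: d' then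
    if swapl x y is Some (y', x') then y' :: insert x' d' else x :: d
  else [:: x].

(* Interchange is used to move layers on the left ahead of layers on the right. *)
Definition norm (d : seq layer) : seq layer :=
  iter (size d) (fun e => foldr insert [::] e) d.

Fixpoint moveback (ds : seq layer) (x : layer) : option (layer * seq layer) :=
  if ds is g :: ds' then
    if moveback ds' x is Some (x', ds'') then
      if swap g x' is Some (x'', g') then Some (x'', g' :: ds'') else None
    else None
  else Some (x, [::]).

(* Reorders a diagram by interchange, in all possible ways, so that layers
   carrying the generators [pat] become adjacent to the block [m]. *)
Fixpoint gather (pre m kept rest : seq layer) (pat : seq gen) :
    seq (seq layer * seq layer * seq layer) :=
  if pat is c :: pat' then
    if rest is y :: rest' then
      (if y.1.2 == c then
         if moveback kept y is Some (y', kept')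
         then gather pre (rcons m y') kept' rest' pat' else [::]
       else [::]) ++
      (* A layer that can precede the block joins [pre], so that [kept] holds only layers that are
         stuck behind the block or behind each other. *)
      (if moveback (m ++ kept) y is Some (y', mk)
       then gather (rcons pre y') (take (size m) mk) (drop (size m) mk) rest' pat
       else gather pre m (rcons kept y) rest' pat)
    else [::]
  else [:: (pre, m, kept ++ rest)].

Fixpoint gather_all (l pre d : seq layer) :=
  match l, d with
  | z :: l', x :: d' =>
      (if x.1.2 == z.1.2
       then gather pre [:: x] [::] d' [seq y.1.2 | y <- l'] else [::])
      ++ gather_all l (rcons pre x) d'
  | _, _ => [::]
  end.

(** The outer strands of an occurrence are read off its first layer; [matches] tests whether the
    other layers agree. *)
Definition context (l m : seq layer) : word * word :=
  if l is z :: _ then if m is x :: _ then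
    (take (size x.1.1 - size z.1.1) x.1.1, drop (size z.2) x.2)
  else ([::], [::]) else ([::], [::]).

Definition matches (l d : seq layer) :=
  [seq r <- gather_all l [::] d |
    let: (pre, m, post) := r in
    m == whisk (context l m).1 (context l m).2 l].

Inductive term := One | Str of strand | Gen of gen | V of term & term
  | H of term & term.

Fixpoint tsrc t : word := match t with
  | One => [::] | Str s => [:: s] | Gen g => gsrc g
  | V _ b => tsrc b | H a b => tsrc a ++ tsrc b end.

Fixpoint ttgt t : word := match t with
  | One => [::] | Str s => [:: s] | Gen g => gtgt g
  | V a _ => ttgt a | H a b => ttgt a ++ ttgt b end.

Fixpoint flat t : seq layer := match t with
  | One | Str _ => [::] | Gen g => [:: ([::], g, [::])]
  | V a b => flat b ++ flat a
  | H a b => whisk [::] (tsrc b) (flat a) ++ whisk (ttgt a) [::] (flat b) end.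

(** * Typing of diagrams and the rewriting step *)

Section Checker.
Variables (okS : pred strand) (okG : pred gen).

Fixpoint wt (w : word) (d : seq layer) : bool :=
  if d is x :: d' then
    [&& w == lsrc x, all okS x.1.1, all okS x.2, okG x.1.2 & wt (ltgt x) d']
  else true.

Fixpoint tok t : bool := match t with
  | One => true | Str s => okS s | Gen g => okG g
  | V a b => [&& tok a, tok b & tsrc a == ttgt b]
  | H a b => tok a && tok b end.

Definition tpair_ok (r : term * term) : bool :=
  [&& tok r.1, tok r.2, tsrc r.1 == tsrc r.2 & ttgt r.1 == ttgt r.2].

(** The occurrence proposed by [matches] is not trusted. The diagram [d1], with the left-hand side
    of the rule in place, is rebuilt, typed, and compared with [d] up to [norm]; if a test fails the
    step leaves [d] alone, which is sound. *)
Definition rewrite1 (w : word) (d : seq layer) (r : term * term) (n : nat) :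
    seq layer :=
  let l := norm (flat r.1) in
  let: (pre, m, post) := nth ([::], [::], [::]) (matches l d) n in
  let: (p, q) := context l m in
  let d1 := pre ++ whisk p q (flat r.1) ++ post in
  if [&& tpair_ok r, all okS p, all okS q, wt w d1,
         dtgt w pre == p ++ tsrc r.1 ++ q & norm d1 == norm d]
  then norm (pre ++ whisk p q (flat r.2) ++ post) else d.

End Checker.

(** * Evaluation of diagrams, and soundness of interchange and rewriting *)

Section Semantics.
Variables (K : TwoCat) (A : Obj K) (X : wdl0 A).
Variables (v : Hom A A) (vb : Cell A A) (xi : nat -> Cell A A).
Variables (okS : pred strand) (okG : pred gen).

Definition sh (s : strand) : Hom A A := if s is Some i then mt (ws X i) else v.
Definition sb (s : strand) : Cell A A := if s is Some i then mtb (ws X i) else vb.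
Definition wh (w : word) : Hom A A := foldr (fun s => comp1 (sh s)) (id1 A) w.
(** In the closure the identity 2-cell of a 1-cell is its idempotent, so whiskering and empty
    diagrams use [wb] in place of [id2]. *)
Definition wb (w : word) : Cell A A :=
  foldr (fun s => hcomp (sb s)) (id2 (id1 A)) w.

Definition gc (g : gen) : Cell A A := match g with
  | Mu i => mmu (ws X i) | Eta i => meta (ws X i) | Law i j => wl X i j
  | Bar i j => lbar (ws X j) (ws X i) (wl X i j) | Xi i => xi i end.

Definition wcell (w w' : word) (a : Cell A A) := bcell (wh w) (wb w) (wh w') (wb w') a.

Hypothesis strandP : forall s, okS s -> idem (sh s) (sb s).
Hypothesis genP : forall g, okG g ->
  [/\ all okS (gsrc g), all okS (gtgt g) & wcell (gsrc g) (gtgt g) (gc g)].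

Lemma wh_cat p q : wh (p ++ q) = comp1 (wh p) (wh q).
Proof. by elim: p => [|s p IH] /=; rewrite ?comp1_id1l // IH comp1A. Qed.

Lemma wb_cat p q : wb (p ++ q) = hcomp (wb p) (wb q).
Proof. by elim: p => [|s p IH] /=; rewrite ?hcomp_id1l // IH hcompA. Qed.

Lemma word_idem w : all okS w -> idem (wh w) (wb w).
Proof.
elim: w => [|s w IH] /=; first by move=> _; apply: idem_id2.
by case/andP=> /strandP Hs /IH; apply: idem_hcomp.
Qed.

Lemma wcell_id w : all okS w -> wcell w w (wb w).
Proof. by move/word_idem; apply: bcell_id. Qed.

Lemma wcell_vcomp u w w' a b : all okS u -> all okS w' ->
  wcell w w' a -> wcell u w b -> wcell u w' (vcomp a b).
Proof.
by move=> /word_idem uP /word_idem wP aP bP; apply: bcell_vcomp uP wP; eassumption.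
Qed.

Lemma wcell_hcomp u u' w w' a b :
  all okS u -> all okS u' -> all okS w -> all okS w' ->
  wcell u u' a -> wcell w w' b -> wcell (u ++ w) (u' ++ w') (hcomp a b).
Proof.
move=> /word_idem uP /word_idem uP' /word_idem wP /word_idem wP' aP bP.
by rewrite /wcell !wh_cat !wb_cat; apply: bcell_hcomp.
Qed.

Lemma wcellA u w w' u' a b c :
  wcell w' u' a -> wcell w w' b -> wcell u w c ->
  vcomp a (vcomp b c) = vcomp (vcomp a b) c.
Proof.
by case=> sa _ _ _ [sb' tb _ _] [_ tc _ _]; rewrite vcompA // ?tc ?sb' ?tb ?sa.
Qed.

Lemma wcell_interchange u u' u'' w w' w'' a b c e :
  wcell u' u'' a -> wcell u u' b -> wcell w' w'' c -> wcell w w' e ->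
  hcomp (vcomp a b) (vcomp c e) = vcomp (hcomp a c) (hcomp b e).
Proof.
by case=> sa _ _ _ [_ tb _ _] [sc _ _ _] [_ te _ _]; rewrite Defs.interchange ?tb ?te.
Qed.

Lemma wcell_idl u w a : wcell u w a -> vcomp (wb w) a = a.
Proof. by case. Qed.

Lemma wcell_idr u w a : wcell u w a -> vcomp a (wb u) = a.
Proof. by case. Qed.

Definition lc (x : layer) : Cell A A :=
  hcomp (wb x.1.1) (hcomp (gc x.1.2) (wb x.2)).

Definition lok (x : layer) := [&& all okS x.1.1, all okS x.2 & okG x.1.2].

Lemma all_lsrc x : lok x -> all okS (lsrc x).
Proof. by case/and3P=> p q /genP[s _ _]; rewrite /lsrc !all_cat p s. Qed.

Lemma all_ltgt x : lok x -> all okS (ltgt x).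
Proof. by case/and3P=> p q /genP[_ s _]; rewrite /ltgt !all_cat p s. Qed.

Lemma lcP x : lok x -> wcell (lsrc x) (ltgt x) (lc x).
Proof.
case/and3P=> p q /genP[s t c].
by do 2 ?[apply: wcell_hcomp]; rewrite ?all_cat ?s ?t ?q //; apply: wcell_id.
Qed.

Fixpoint dc (w : word) (d : seq layer) : Cell A A :=
  if d is x :: d' then vcomp (dc (ltgt x) d') (lc x) else wb w.

Lemma wt_cons w x d :
  wt okS okG w (x :: d) = [&& w == lsrc x, lok x & wt okS okG (ltgt x) d].
Proof. by rewrite /= /lok -!andbA. Qed.

Lemma dtgt_cons w x d : dtgt w (x :: d) = dtgt (ltgt x) d.
Proof. by []. Qed.

Lemma all_dtgt w d : all okS w -> wt okS okG w d -> all okS (dtgt w d).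
Proof.
elim: d w => //= x d IH w ow /and5P[_ p q g]; apply: IH.
by rewrite all_ltgt // /lok p q.
Qed.

Lemma dcP w d : all okS w -> wt okS okG w d -> wcell w (dtgt w d) (dc w d).
Proof.
elim: d w => [|x d IH] w ow; first by move=> _; apply: wcell_id.
rewrite wt_cons dtgt_cons => /and3P[/eqP we lx wd].
apply: (@wcell_vcomp _ (ltgt x)) => //; first exact: all_dtgt (all_ltgt lx) wd.
  exact: IH (all_ltgt lx) wd.
by rewrite we; apply: lcP.
Qed.

Lemma dtgt_cat w d e : dtgt w (d ++ e) = dtgt (dtgt w d) e.
Proof. by rewrite /dtgt map_cat last_cat. Qed.

Lemma wt_cat w d e :
  wt okS okG w (d ++ e) = wt okS okG w d && wt okS okG (dtgt w d) e.
Proof. by elim: d w => //= x d IH w; rewrite IH -!andbA. Qed.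

Lemma dc_cat w d e : all okS w -> wt okS okG w d -> wt okS okG (dtgt w d) e ->
  dc w (d ++ e) = vcomp (dc (dtgt w d) e) (dc w d).
Proof.
elim: d w => [|x d IH] w ow.
  by move=> _ we; rewrite /= (wcell_idr (dcP ow we)).
rewrite wt_cons dtgt_cons => /and3P[/eqP we lx wd] wd' /=.
have ox := all_ltgt lx; rewrite IH //.
by rewrite -(wcellA (dcP (all_dtgt ox wd) wd') (dcP ox wd) (lcP lx)).
Qed.

Lemma lok_whisk p q x : all okS p -> all okS q -> lok x ->
  lok (p ++ x.1.1, x.1.2, x.2 ++ q).
Proof.
by move=> op oq /and3P[h1 h2 h3]; rewrite /lok /= !all_cat op h1 h2 oq h3.
Qed.

Lemma lsrc_whisk p q x : lsrc (p ++ x.1.1, x.1.2, x.2 ++ q) = p ++ lsrc x ++ q.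
Proof. by rewrite /lsrc /= !catA. Qed.

Lemma ltgt_whisk p q x : ltgt (p ++ x.1.1, x.1.2, x.2 ++ q) = p ++ ltgt x ++ q.
Proof. by rewrite /ltgt /= !catA. Qed.

Lemma dtgt_whisk p q w d : dtgt (p ++ w ++ q) (whisk p q d) = p ++ dtgt w d ++ q.
Proof.
by elim: d w => // x d IH w; rewrite [whisk _ _ _]/= !dtgt_cons ltgt_whisk IH.
Qed.

Lemma wt_whisk p q w d : all okS p -> all okS q -> wt okS okG w d ->
  wt okS okG (p ++ w ++ q) (whisk p q d).
Proof.
move=> op oq; elim: d w => // x d IH w; rewrite wt_cons => /and3P[/eqP-> lx wd].
rewrite [whisk _ _ _]/= wt_cons lsrc_whisk eqxx lok_whisk //= ltgt_whisk; exact: IH.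
Qed.

Lemma dc_whisk p q w d : all okS p -> all okS q -> all okS w -> wt okS okG w d ->
  dc (p ++ w ++ q) (whisk p q d) = hcomp (wb p) (hcomp (dc w d) (wb q)).
Proof.
move=> op oq; elim: d w => [|x d IH] w ow; first by rewrite /= !wb_cat.
rewrite wt_cons => /and3P[/eqP we lx wd].
rewrite [whisk _ _ _]/= [LHS]/= ltgt_whisk IH ?all_ltgt //.
have -> : lc (p ++ x.1.1, x.1.2, x.2 ++ q) = hcomp (wb p) (hcomp (lc x) (wb q)).
  by rewrite /lc /= !wb_cat !hcompA.
have [ox oy] := (all_lsrc lx, all_ltgt lx).
have [ip iq] := (wcell_id op, wcell_id oq).
have [cd cx] := (dcP oy wd, lcP lx).
have hd := wcell_hcomp oy (all_dtgt oy wd) oq oq cd iq.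
have hx := wcell_hcomp ox oy oq oq cx iq.
rewrite -(wcell_interchange ip ip hd hx) (wcell_idl ip).
by rewrite -(wcell_interchange cd cx iq iq) (wcell_idl iq).
Qed.

Lemma swap_sound x y x' y' w d : all okS w ->
  swap x y = Some (y', x') -> wt okS okG w [:: x, y & d] ->
  [/\ wt okS okG w [:: y', x' & d], dtgt w [:: y', x' & d] = dtgt w [:: x, y & d]
    & dc w [:: y', x' & d] = dc w [:: x, y & d]].
Proof.
(* One configuration serves both swaps: [c] on the left and [c'] on the right, separated by [q].
   Read forwards it is [swapr], read backwards [swapl]. *)
suff main p c q c' r :
    let x1 := (p, c, q ++ gsrc c' ++ r) in
    let y1 := (p ++ gtgt c ++ q, c', r) in
    let y2 := (p ++ gsrc c ++ q, c', r) in
    let x2 := (p, c, q ++ gtgt c' ++ r) in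
    all okS w ->
    (wt okS okG w [:: x1, y1 & d] = wt okS okG w [:: y2, x2 & d]) /\
    (dtgt w [:: x1, y1 & d] = dtgt w [:: y2, x2 & d]) /\
    (wt okS okG w [:: x1, y1 & d] -> dc w [:: x1, y1 & d] = dc w [:: y2, x2 & d]).
  move=> ow; case: x y => [[p c] q] [[p' c'] q']; rewrite /swap /=.
  set m := drop _ p; case: ifP => [/andP[/eqP pE /eqP qE] [<- <-]|_].
    have /= [e1 [e2 e3]] := main p' c' m c q ow.
    move: e1 e2 e3; rewrite -pE -qE => e1 e2 e3.
    by move=> h; move: (h); rewrite -e1 => h'; rewrite e1 -e2 -e3.
  move: m => _; set m := drop _ p'; case: ifP => // /andP[/eqP pE /eqP qE] [<- <-].
  have /= [e1 [e2 e3]] := main p c m c' q' ow.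
  by move: e1 e2 e3; rewrite -pE -qE => e1 e2 e3 h; rewrite -e1 e2 e3.
move=> x1 y1 y2 x2 ow; rewrite !wt_cons !dtgt_cons.
have -> : lsrc y1 = ltgt x1 by rewrite /lsrc /ltgt /= !catA.
have -> : lsrc x2 = ltgt y2 by rewrite /lsrc /ltgt /= !catA.
have -> : lsrc y2 = lsrc x1 by rewrite /lsrc /ltgt /= !catA.
have e : ltgt x2 = ltgt y1 by rewrite /lsrc /ltgt /= !catA.
rewrite e !eqxx !andTb.
have lE : lok x1 && lok y1 = lok y2 && lok x2.
  rewrite /lok /x1 /y1 /x2 /y2 /= !all_cat.
  case gP: (okG c); last by rewrite !andbF.
  case gP': (okG c'); last by rewrite !andbF.
  have [s t _] := genP gP; have [s' t' _] := genP gP'.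
  by rewrite s t s' t' !andbT /=; case: all => //; case: all => //; case: all.
split; first by rewrite (andbA (lok x1)) lE -andbA.
split=> // /and3P[/eqP wE l1 /andP[l2 wd]].
have /andP[l3 l4] : lok y2 && lok x2 by rewrite -lE l1.
have o1 := all_ltgt l2.
have E : ltgt x1 = lsrc y1 by rewrite /lsrc /ltgt /= !catA.
have E' : ltgt y2 = lsrc x2 by rewrite /lsrc /ltgt /= !catA.
have c1 := lcP l1; rewrite E in c1.
have c3 := lcP l3; rewrite E' in c3.
have c4 := lcP l4; rewrite e in c4.
have c0 := dcP o1 wd.
rewrite -[LHS]/(vcomp (vcomp (dc (ltgt y1) d) (lc y1)) (lc x1)).
rewrite -[RHS]/(vcomp (vcomp (dc (ltgt x2) d) (lc x2)) (lc y2)) e.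
rewrite -(wcellA c0 (lcP l2) c1) -(wcellA c0 c4 c3); congr vcomp.
case/and3P: l1 => /= op; rewrite !all_cat => /and3P[oq _ or] gc1.
case/and3P: l2 => /= _ _ gc2.
have [s t h] := genP gc1; have [s' t' h'] := genP gc2.
rewrite /lc /= !wb_cat -!hcompA.
have [ip [iq ir]] := (wcell_id op, (wcell_id oq, wcell_id or)).
have it := wcell_id t; have is_ := wcell_id s.
have it' := wcell_id t'; have is'_ := wcell_id s'.
have wA1 := wcell_hcomp s' t' or or h' ir.
have wA2 := wcell_hcomp s' s' or or is'_ ir.
have wA3 := wcell_hcomp t' t' or or it' ir.
have [a1 a2] : all okS (gsrc c' ++ r) /\ all okS (gtgt c' ++ r).
  by rewrite !all_cat s' t' or.
have wB1 := wcell_hcomp oq oq a1 a2 iq wA1.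
have wB2 := wcell_hcomp oq oq a1 a1 iq wA2.
have wB3 := wcell_hcomp oq oq a2 a2 iq wA3.
have [b1 b2] : all okS (q ++ gsrc c' ++ r) /\ all okS (q ++ gtgt c' ++ r).
  by rewrite !all_cat oq s' t' or.
have wC1 := wcell_hcomp t t b1 b2 it wB1.
have wC2 := wcell_hcomp s t b1 b1 h wB2.
have wC3 := wcell_hcomp s t b2 b2 h wB3.
have wC4 := wcell_hcomp s s b1 b2 is_ wB1.
rewrite -(wcell_interchange ip ip wC1 wC2) -(wcell_interchange ip ip wC3 wC4).
(* Both orders of the two layers collapse to the horizontal composite of the two generators. *)
congr hcomp; rewrite -(wcell_interchange it h wB1 wB2) -(wcell_interchange h is_ wB3 wB1).
rewrite (wcell_idl h) (wcell_idr h); congr hcomp.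
by rewrite -!wb_cat (wcell_idr wB1) (wcell_idl wB1).
Qed.

(** Typing of [e] belongs to the conclusion, so that such steps can be chained from the typing of
    [d] alone. *)
Definition dequiv w d e := wt okS okG w d ->
  [/\ wt okS okG w e, dtgt w e = dtgt w d & dc w e = dc w d].

Lemma dequiv_cons w x d e : dequiv (ltgt x) d e -> dequiv w (x :: d) (x :: e).
Proof.
move=> h; rewrite /dequiv !wt_cons !dtgt_cons => /and3P[-> -> /h[-> -> /=]].
by move->.
Qed.

Lemma dequiv_trans w d e f : dequiv w d e -> dequiv w e f -> dequiv w d f.
Proof. by move=> h h' /h[/h'[-> -> ->] -> ->]. Qed.

Lemma insert_sound w x d : all okS w -> dequiv w (x :: d) (insert x d).
Proof.
elim: d w x => [|y d IH] w x ow //=.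
case E: (swapl x y) => [[y' x']|] //.
have {}E : swap x y = Some (y', x') by rewrite /swap E.
apply: (@dequiv_trans _ _ [:: y', x' & d]); first exact: swap_sound.
move=> h; apply: dequiv_cons (h); apply: IH.
by move: h; rewrite wt_cons => /and3P[_ /all_ltgt].
Qed.

Lemma norm_sound w d : all okS w -> dequiv w d (norm d).
Proof.
move=> ow; rewrite /norm; elim: (size d) => [|n IH] //=.
apply: dequiv_trans IH _; elim: (iter _ _ _) w ow => [|x e IH] w ow //= h.
apply: (dequiv_trans _ (insert_sound ow)) (h); apply: dequiv_cons; apply: IH.
by move: h; rewrite wt_cons => /and3P[_ /all_ltgt].
Qed.

Fixpoint teval t : Cell A A := match t with
  | One => id2 (id1 A) | Str s => sb s | Gen g => gc g
  | V a b => vcomp (teval a) (teval b) | H a b => hcomp (teval a) (teval b) end.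

Lemma tokP t : tok okS okG t ->
  [/\ all okS (tsrc t), all okS (ttgt t), wt okS okG (tsrc t) (flat t),
      dtgt (tsrc t) (flat t) = ttgt t & dc (tsrc t) (flat t) = teval t].
Proof.
elim: t => [|s|g|a IHa b IHb|a IHa b IHb] //=.
- by move=> ->; rewrite hcomp_id1r.
- move=> /[dup] og /genP[s t [? ? e1 e2]].
  rewrite s t og /dtgt /lsrc /ltgt /lc /= !cats0 eqxx hcomp_id1l hcomp_id1r.
  by split.
- case/and3P=> /IHa[sa ta wa ea ca] /IHb[sb' tb wb' eb cb] /eqP e.
  by rewrite wt_cat wb' dtgt_cat eb -e wa ea dc_cat ?eb -?e ?ca ?cb.
case/andP=> /IHa[sa ta wa ea ca] /IHb[sb' tb wb' eb cb].
have h1 := @wt_whisk [::] _ _ _ isT sb' wa.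
have h2 := @wt_whisk _ [::] _ _ ta isT wb'; rewrite !cats0 in h2.
have e1 := @dtgt_whisk [::] (tsrc b) (tsrc a) (flat a); rewrite /= ea in e1.
have e2 := @dtgt_whisk (ttgt a) [::] (tsrc b) (flat b); rewrite !cats0 eb in e2.
have oab : all okS (tsrc a ++ tsrc b) by rewrite all_cat sa.
rewrite !all_cat sa sb' ta tb wt_cat h1 dtgt_cat e1 h2 e2; split=> //.
rewrite dc_cat //= ?e1 //.
have -> := @dc_whisk [::] _ _ _ isT sb' sa wa; rewrite hcomp_id1l ca.
have := @dc_whisk _ [::] _ _ ta isT sb' wb'; rewrite !cats0 hcomp_id1r cb => ->.
have fa := dcP sa wa; rewrite ea ca in fa.
have fb := dcP sb' wb'; rewrite eb cb in fb.
rewrite -(wcell_interchange (wcell_id ta) fa fb (wcell_id sb')).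
by rewrite (wcell_idl fa) (wcell_idr fb).
Qed.

Lemma rewrite1_sound w d r n : all okS w -> teval r.1 = teval r.2 ->
  dequiv w d (rewrite1 okS okG w d r n).
Proof.
move=> ow rE wd; rewrite /rewrite1.
case: nth => [[pre m] post]; case: context => p q.
case: ifP => // /andP[] /and4P[/tokP[s1 t1 w1 d1 c1] /tokP[s2 t2 w2 d2 c2] /eqP es /eqP et].
case/and5P=> op oq wd1 /eqP e0 /eqP en.
rewrite -es in w2 d2 c2; rewrite -et in d2.
have [n1 n2 n3] := norm_sound ow wd1; have [m1 m2 m3] := norm_sound ow wd.
have h1 := wt_whisk op oq w1; have h2 := wt_whisk op oq w2.
move: wd1; rewrite !wt_cat !e0 h1 dtgt_whisk d1 => /and3P[wp _ wq].
have wd' : wt okS okG w (pre ++ whisk p q (flat r.2) ++ post).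
  by rewrite !wt_cat e0 h2 wp dtgt_whisk d2.
have [k1 k2 k3] := norm_sound ow wd'.
have od := all_dtgt ow wp; rewrite e0 in od.
(* The rewritten block is isolated as a middle factor, in the same way for both sides of the
   rule. *)
have dE f : wt okS okG (tsrc r.1) f -> dtgt (tsrc r.1) f = ttgt r.1 ->
    dc w (pre ++ whisk p q f ++ post) = vcomp (vcomp (dc (p ++ ttgt r.1 ++ q) post)
      (hcomp (wb p) (hcomp (dc (tsrc r.1) f) (wb q)))) (dc w pre).
  move=> wf ef; have hf := wt_whisk op oq wf.
  by rewrite !dc_cat ?wt_cat ?e0 ?hf ?dtgt_whisk ?ef ?dc_whisk.
split=> //; first by rewrite k2 -m2 -en n2 !dtgt_cat e0 !dtgt_whisk d1 d2.
by rewrite k3 -m3 -en n3 !dE // c1 c2 rE.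
Qed.

End Semantics.

(** * Rewriting rules *)

(* [As], [UL], [UR] are the monad axioms and [A1], [A2], [A3r], [A4r] the axioms
   of a weak distributive law, [A3] and [A4] being the last two expressed with
   the idempotent of the law.  [Bd] and [Bd'] are the two formulas for that
   idempotent; in the next six rules it is moved past a multiplication ([BL],
   [BR]) or absorbed.  [XM], [XE], [XL] are the axioms of 1-cells. *)
Inductive rule := As of nat | UL of nat | UR of nat
  | A1 of nat & nat | A2 of nat & nat | A3r of nat & nat | A4r of nat & nat
  | Bd of nat & nat | YB of nat & nat & nat
  | XM of nat | XE of nat | XL of nat & nat
  | A3 of nat & nat | A4 of nat & nat | Bd' of nat & nat
  | BL of nat & nat | BR of nat & nat | BA of nat & nat | BB of nat & nat
  | BM of nat & nat | MB of nat & nat.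

Notation S' i := (Str (Some i)).
Notation V' := (Str None).

Definition rterm (r : rule) : term * term := match r with
  | As i => (V (Gen (Mu i)) (H (Gen (Mu i)) (S' i)),
             V (Gen (Mu i)) (H (S' i) (Gen (Mu i))))
  | UL i => (V (Gen (Mu i)) (H (Gen (Eta i)) (S' i)), S' i)
  | UR i => (V (Gen (Mu i)) (H (S' i) (Gen (Eta i))), S' i)
  | A1 i j => let l := Gen (Law i j) in
      (V l (H (Gen (Mu j)) (S' i)),
       V (H (S' i) (Gen (Mu j))) (V (H l (S' j)) (H (S' j) l)))
  | A2 i j => let l := Gen (Law i j) in
      (V l (H (S' j) (Gen (Mu i))),
       V (H (Gen (Mu i)) (S' j)) (V (H (S' i) l) (H l (S' i))))
  | A3r i j => let l := Gen (Law i j) in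
      (V l (H (Gen (Eta j)) (S' i)),
       V (H (Gen (Mu i)) (S' j)) (V (H (S' i) l)
         (V (H (H (S' i) (S' j)) (Gen (Eta i))) (H (S' i) (Gen (Eta j))))))
  | A4r i j => let l := Gen (Law i j) in
      (V l (H (S' j) (Gen (Eta i))),
       V (H (S' i) (Gen (Mu j))) (V (H l (S' j))
         (V (H (Gen (Eta j)) (H (S' i) (S' j))) (H (Gen (Eta i)) (S' j)))))
  | Bd i j => (Gen (Bar i j),
       V (H (Gen (Mu i)) (S' j)) (V (H (S' i) (Gen (Law i j)))
         (H (H (S' i) (S' j)) (Gen (Eta i)))))
  | YB i j k =>
      (V (H (Gen (Law i j)) (S' k))
         (V (H (S' j) (Gen (Law i k))) (H (Gen (Law j k)) (S' i))),
       V (H (S' i) (Gen (Law j k)))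
         (V (H (Gen (Law i k)) (S' j)) (H (S' k) (Gen (Law i j)))))
  | XM i => (V (Gen (Xi i)) (H (Gen (Mu (i + 4))) V'),
       V (H V' (Gen (Mu i))) (V (H (Gen (Xi i)) (S' i)) (H (S' (i + 4)) (Gen (Xi i)))))
  | XE i => (V (Gen (Xi i)) (H (Gen (Eta (i + 4))) V'), H V' (Gen (Eta i)))
  | XL i j =>
      (V (H V' (Gen (Law i j)))
         (V (H (Gen (Xi j)) (S' i)) (H (S' (j + 4)) (Gen (Xi i)))),
       V (H V' (Gen (Bar i j))) (V (H (Gen (Xi i)) (S' j))
         (V (H (S' (i + 4)) (Gen (Xi j))) (H (Gen (Law (i + 4) (j + 4))) V'))))
  | A3 i j => (V (Gen (Law i j)) (H (Gen (Eta j)) (S' i)),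
       V (Gen (Bar i j)) (H (S' i) (Gen (Eta j))))
  | A4 i j => (V (Gen (Law i j)) (H (S' j) (Gen (Eta i))),
       V (Gen (Bar i j)) (H (Gen (Eta i)) (S' j)))
  | Bd' i j => (Gen (Bar i j),
       V (H (S' i) (Gen (Mu j))) (V (H (Gen (Law i j)) (S' j))
         (H (Gen (Eta j)) (H (S' i) (S' j)))))
  | BL i j => (V (Gen (Bar i j)) (H (Gen (Mu i)) (S' j)),
       V (H (Gen (Mu i)) (S' j)) (H (S' i) (Gen (Bar i j))))
  | BR i j => (V (Gen (Bar i j)) (H (S' i) (Gen (Mu j))),
       V (H (S' i) (Gen (Mu j))) (H (Gen (Bar i j)) (S' j)))
  | BA i j => (V (Gen (Bar i j)) (Gen (Law i j)), Gen (Law i j))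
  | BB i j => (V (Gen (Bar i j)) (Gen (Bar i j)), Gen (Bar i j))
  | BM i j =>
      (V (H (Gen (Mu i)) (S' j)) (V (H (S' i) (Gen (Law i j))) (H (Gen (Bar i j)) (S' i))),
       V (H (Gen (Mu i)) (S' j)) (H (S' i) (Gen (Law i j))))
  | MB i j =>
      (V (H (S' i) (Gen (Mu j))) (V (H (Gen (Law i j)) (S' j)) (H (S' j) (Gen (Bar i j)))),
       V (H (S' i) (Gen (Mu j))) (H (Gen (Law i j)) (S' j)))
  end.

(* A step applies a rule, read backwards if the flag is set, at the given
   occurrence. *)
Definition step := (rule * bool * nat)%type.
Definition fwd r : step := (r, false, 0).
Definition bwd r : step := (r, true, 0).

Definition step_terms (s : step) : term * term :=
  let: (r, b, _) := s in
  if b then ((rterm r).2, (rterm r).1) else rterm r.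

(* Monads 0, ..., a - 1 live on the source and 4, ..., b + 3 on the target. *)
Definition okM a b i := (i < a) || (4 <= i < b + 4).
Definition okL a b i j := (i < j) && ((j < a) || (4 <= i) && (j < b + 4)).
Definition okX a b i := (i < a) && (i < b).

Definition okS a b (s : strand) := if s is Some i then okM a b i else true.
Definition okG a b (g : gen) := match g with
  | Mu i | Eta i => okM a b i | Law i j | Bar i j => okL a b i j
  | Xi i => okX a b i end.

Definition basic_rule a b (r : rule) := match r with
  | As i | UL i | UR i => okM a b i
  | A1 i j | A2 i j | A3r i j | A4r i j | Bd i j => okL a b i j
  | YB i j k => okL a b i j && okL a b j k
  | XM i | XE i => okX a b i
  | XL i j => [&& okX a b i, okX a b j & i < j]
  | _ => false end.

Definition derived_rule a b (r : rule) := match r with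
  | A3 i j | A4 i j | Bd' i j | BL i j | BR i j | BA i j | BB i j | BM i j
  | MB i j => okL a b i j
  | _ => false end.

Definition any_rule a b r := basic_rule a b r || derived_rule a b r.

Definition run okS okG t (ss : seq step) : seq layer :=
  foldl (fun d s => rewrite1 okS okG (tsrc t) d (step_terms s) s.2)
    (norm (flat t)) ss.

Definition check (ok : pred rule) a b t1 t2 ss1 ss2 :=
  [&& tpair_ok (okS a b) (okG a b) (t1, t2), all (fun s => ok s.1.1) (ss1 ++ ss2)
    & run (okS a b) (okG a b) t1 ss1 == run (okS a b) (okG a b) t2 ss2].

(** A single object carries all the monads and the 1-cell [v], because a word may mix them. For
    statements about 0-cells, [b] is 0 and [v] is the identity; a 1-cell between two objects is
    brought into this form by [link_env]. *)
Record diag_env a b (K : TwoCat) (A : Obj K) (X : wdl0 A) (v : Hom A A)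
    (vb : Cell A A) (xi : nat -> Cell A A) : Prop := DiagEnv {
  env_monad : forall i, okM a b i -> is_bmonad (ws X i);
  env_law : forall i j, okL a b i j -> is_wdl (ws X j) (ws X i) (wl X i j);
  env_yb : forall i j k, okL a b i j -> okL a b j k ->
    vcomp (hcomp (wl X i j) (mtb (ws X k)))
      (vcomp (hcomp (mtb (ws X j)) (wl X i k)) (hcomp (wl X j k) (mtb (ws X i))))
    = vcomp (hcomp (mtb (ws X i)) (wl X j k))
      (vcomp (hcomp (wl X i k) (mtb (ws X j))) (hcomp (mtb (ws X k)) (wl X i j)));
  env_v : idem v vb;
  env_xi : forall i, okX a b i ->
    is_mnd1 (ws X i) (ws X (i + 4)) v vb (xi i);
  env_xil : forall i j, okX a b i -> okX a b j -> i < j ->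
    vcomp (hcomp vb (wl X i j))
      (vcomp (hcomp (xi j) (mtb (ws X i))) (hcomp (mtb (ws X (j + 4))) (xi i)))
    = vcomp (hcomp vb (lbar (ws X j) (ws X i) (wl X i j)))
      (vcomp (hcomp (xi i) (mtb (ws X j)))
        (vcomp (hcomp (mtb (ws X (i + 4))) (xi j))
               (hcomp (wl X (i + 4) (j + 4)) vb)))
}.

(** * Soundness of a checked list of steps *)

Section Soundness.
Variables (a b : nat) (K : TwoCat) (A : Obj K) (X : wdl0 A).
Variables (v : Hom A A) (vb : Cell A A) (xi : nat -> Cell A A).
Hypothesis env : diag_env a b X v vb xi.

Lemma okL_okM i j : okL a b i j -> okM a b i /\ okM a b j.
Proof.
rewrite /okL /okM => /andP[ij /orP[ja|/andP[i4 jb]]].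
  by rewrite ja (ltn_trans ij ja).
by rewrite i4 jb (ltn_trans ij jb) (leq_trans i4 (ltnW ij)) !orbT.
Qed.

Lemma okX_okM i : okX a b i -> okM a b i /\ okM a b (i + 4).
Proof. by rewrite /okX /okM => /andP[-> ib]; rewrite leq_addl ltn_add2r ib orbT. Qed.

Lemma env_strand s : okS a b s -> idem (sh X v s) (sb X vb s).
Proof.
case: s => [i|] /=; last by move=> _; apply: (env_v env).
by case/(env_monad env).
Qed.

Lemma lbar_bcell i j : okL a b i j ->
  bcell (comp1 (mt (ws X i)) (mt (ws X j))) (hcomp (mtb (ws X i)) (mtb (ws X j)))
    (comp1 (mt (ws X i)) (mt (ws X j))) (hcomp (mtb (ws X i)) (mtb (ws X j)))
    (lbar (ws X j) (ws X i) (wl X i j)).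
Proof.
move=> ok; have [/(env_monad env)[si mi ei _ _] /(env_monad env)[sj _ _ _ _]] := okL_okM ok.
case: (env_law env ok) => lP _ _ _ _.
have [ii jj] := (bcell_id si, bcell_id sj).
have sij := idem_hcomp si sj; have sii := idem_hcomp si si.
have siij := idem_hcomp sii sj; have siji := idem_hcomp sij si.
apply: (bcell_vcomp (bcell_hcomp mi jj sii si sj sj)) => //.
have ll := bcell_hcomp ii lP si si (idem_hcomp sj si) sij.
rewrite !comp1A !hcompA in ll.
apply: (bcell_vcomp ll) => //.
have i1 := @idem_id2 K A A (id1 A).
have := bcell_hcomp (bcell_id sij) ei sij sij i1 si.
by rewrite comp1_id1r hcomp_id1r.
Qed.

Lemma env_gen g : okG a b g -> [/\ all (okS a b) (gsrc g), all (okS a b) (gtgt g)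
  & wcell X v vb (gsrc g) (gtgt g) (gc X xi g)].
Proof.
case: g => [i|i|i j|i j|i] /=; rewrite /wcell /= ?comp1_id1r ?hcomp_id1r.
- by move=> oi; rewrite oi; case: (env_monad env oi).
- by move=> oi; rewrite oi; case: (env_monad env oi).
- by move=> oij; have [-> ->] := okL_okM oij; case: (env_law env oij).
- by move=> oij; have [-> ->] := okL_okM oij; split=> //; apply: lbar_bcell.
by move=> oi; have [-> ->] := okX_okM oi; case: (env_xi env oi).
Qed.

Definition valid r :=
  teval X vb xi (rterm r).1 = teval X vb xi (rterm r).2.

Lemma check_sound (ok : pred rule) t1 t2 ss1 ss2 :
  (forall r, ok r -> valid r) -> check ok a b t1 t2 ss1 ss2 ->
  teval X vb xi t1 = teval X vb xi t2.
Proof.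
move=> okP /and3P[/and4P[/= ok1 ok2 /eqP es /eqP et]].
rewrite all_cat => /andP[o1 o2] /eqP E.
have main t ss : tok (okS a b) (okG a b) t -> all (fun s : step => ok s.1.1) ss ->
    dc X vb xi (tsrc t) (run (okS a b) (okG a b) t ss) = teval X vb xi t.
  move=> /(tokP env_strand env_gen)[st _ wt_t _ ct] oss.
  rewrite -ct /run.
  have [wn _ <-] := norm_sound env_strand env_gen st wt_t.
  elim: ss (norm _) wn oss => //= -[[r c] n] ss IH d wd /andP[/= or oss].
  have vr : teval X vb xi (step_terms (r, c, n)).1 = teval X vb xi (step_terms (r, c, n)).2.
    by rewrite /=; case: c; rewrite /= (okP _ or).
  have [wd' _ e] :=
    @rewrite1_sound _ _ _ _ _ _ _ _ env_strand env_gen _ _ _ n st vr wd.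
  by rewrite IH // -e.
by rewrite -(main _ _ ok1 o1) -(main _ _ ok2 o2) E es.
Qed.

Lemma basic_ruleP r : basic_rule a b r -> valid r.
Proof.
case: r => [i|i|i|i j|i j|i j|i j|i j|i j k|i|i|i j|||||||||] //=; rewrite /valid /=.
- by case/(env_monad env).
- by case/(env_monad env)=> _ _ _ _ [].
- by case/(env_monad env)=> _ _ _ _ [].
- by case/(env_law env).
- by case/(env_law env).
- by case/(env_law env).
- by case/(env_law env).
- by case/andP; apply: (env_yb env).
- by case/(env_xi env).
- by case/(env_xi env).
by case/and3P; apply: (env_xil env).
Qed.

End Soundness.

(** * Reification of 2-cells built from weak wreath products *)

Section WreathData.
Variables (K : TwoCat) (A : Obj K).

(** The formulas of [Ck0] and [Ck1] as functions of their constituents, which may themselves be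
    wreath products; in this form [reify] recognises them. *)
Definition law_wreathl (S T U : bmonad A) (lST lSU lTU : Cell A A) : Cell A A :=
  vcomp (hcomp (mtb S) lTU)
    (vcomp (hcomp lSU (mtb T)) (hcomp (mtb U) (lbar T S lST))).

Definition law_wreathr (U S T : bmonad A) (lUS lUT lST : Cell A A) : Cell A A :=
  vcomp (hcomp lUS (mtb T))
    (vcomp (hcomp (mtb S) lUT) (hcomp (lbar T S lST) (mtb U))).

Definition xi_wreath (B : Obj K) (S T : bmonad A) (S' : bmonad B) (lST : Cell A A)
    (vb xiS xiT : Cell A B) : Cell A B :=
  vcomp (hcomp vb (lbar T S lST)) (vcomp (hcomp xiS (mtb T)) (hcomp (mtb S') xiT)).

End WreathData.

(** The order of the clauses matters: the idempotent of a given law becomes a generator, and any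
    other [lbar], such as that of a composite law, is unfolded. *)
Ltac reify X vb xi t :=
  let go := reify X vb xi in
  lazymatch t with
  | vcomp ?p ?q => let p' := go p in let q' := go q in constr:(V p' q')
  | hcomp ?p ?q => let p' := go p in let q' := go q in constr:(H p' q')
  | id2 (id1 _) => constr:(One)
  | vb => constr:(Str None)
  | xi ?i => constr:(Gen (Xi i))
  | mtb (ws X ?i) => constr:(Str (Some i))
  | mmu (ws X ?i) => constr:(Gen (Mu i))
  | meta (ws X ?i) => constr:(Gen (Eta i))
  | wl X ?i ?j => constr:(Gen (Law i j))
  | lbar (ws X ?j) (ws X ?i) (wl X ?i ?j) => constr:(Gen (Bar i j))
  | mtb (wreath ?T ?S ?l) => go (lbar T S l)
  | mmu (wreath ?T ?S ?l) =>
      go (vcomp (hcomp (mmu S) (mmu T)) (hcomp (mtb S) (hcomp l (mtb T))))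
  | meta (wreath ?T ?S ?l) => go (vcomp l (hcomp (meta T) (meta S)))
  | lbar ?T ?S ?l =>
      go (vcomp (hcomp (mmu S) (mtb T))
            (vcomp (hcomp (mtb S) l) (hcomp (hcomp (mtb S) (mtb T)) (meta S))))
  | law_wreathl ?S ?T ?U ?lST ?lSU ?lTU =>
      go (vcomp (hcomp (mtb S) lTU)
            (vcomp (hcomp lSU (mtb T)) (hcomp (mtb U) (lbar T S lST))))
  | law_wreathr ?U ?S ?T ?lUS ?lUT ?lST =>
      go (vcomp (hcomp lUS (mtb T))
            (vcomp (hcomp (mtb S) lUT) (hcomp (lbar T S lST) (mtb U))))
  | xi_wreath ?S ?T ?S' ?lST ?vb' ?xiS ?xiT =>
      go (vcomp (hcomp vb' (lbar T S lST))
            (vcomp (hcomp xiS (mtb T)) (hcomp (mtb S') xiT)))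
  end.

(** The lists [ss1] and [ss2] rewrite the two sides to a common diagram. The [change] lets
    conversion confirm that reification was faithful. *)
Ltac diagram_by a b X v vb xi env okP ss1 ss2 :=
  lazymatch goal with |- ?l = ?r =>
    let t1 := reify X vb xi l in
    let t2 := reify X vb xi r in
    change (teval X vb xi t1 = teval X vb xi t2);
    apply: (@check_sound a b _ _ X v vb xi env _ t1 t2 ss1 ss2 okP);
    vm_compute; reflexivity
  end.

Definition xi0 (K : TwoCat) (A : Obj K) (i : nat) : Cell A A := id2 (id1 A).

Lemma wdl0_env n (K : TwoCat) (A : Obj K) (X : wdl0 A) : n < 4 -> is_wdl0 n X ->
  diag_env n.+1 0 X (id1 A) (id2 (id1 A)) (@xi0 K A).
Proof.
move=> n4 [hm hl hy]; have no4 i : 4 <= i < 4 = false.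
  by apply/negP=> /andP[h /leq_trans/(_ h)]; rewrite ltnn.
split; rewrite /okM /okL /okX /= ?add0n.
- by move=> i; rewrite no4 orbF ltnS; apply: hm.
- move=> i j /andP[ij /orP[|/andP[i4 j4]]]; first by rewrite ltnS; apply: hl.
  by move: (ltn_trans (leq_ltn_trans i4 ij) j4); rewrite ltnn.
- move=> i j k /andP[ij _] /andP[jk /orP[|/andP[i4 j4]]].
    by rewrite ltnS; apply: hy.
  by move: (ltn_trans (leq_ltn_trans i4 jk) j4); rewrite ltnn.
- exact: idem_id2.
- by move=> i /andP[].
by move=> i j /andP[].
Qed.

(** * Derived rules for a single weak distributive law *)

Section Derived.
Variables (K : TwoCat) (A : Obj K) (S T : bmonad A) (l : Cell A A).
Hypotheses (Sm : is_bmonad S) (Tm : is_bmonad T) (lP : is_wdl T S l).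

Let X := WDL0 (fun i => if i is 0 then S else T) (fun _ _ => l).

Lemma pair_env : diag_env 2 0 X (id1 A) (id2 (id1 A)) (@xi0 K A).
Proof.
apply: wdl0_env => //; split=> /=.
- by case.
- by case=> [|i] [|[|j]].
by case=> [|i] [|[|j]] // [|[|k]].
Qed.

Local Ltac derive r ss1 ss2 :=
  change (valid X (id2 (id1 A)) (@xi0 K A) r);
  apply: (@check_sound 2 0 _ _ X (id1 A) _ _ pair_env _ _ _ ss1 ss2
    (basic_ruleP pair_env)); vm_compute; reflexivity.

Lemma wdl_etaT : vcomp l (hcomp (meta T) (mtb S))
  = vcomp (lbar T S l) (hcomp (mtb S) (meta T)).
Proof. derive (A3 0 1) [:: fwd (A3r 0 1)] [:: fwd (Bd 0 1)]. Qed.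

(** Both formulas expand to the same diagram: the two units are inserted between [s] and [t],
    crossed by the law, and multiplied into the outer strands. *)
Lemma lbar_def' : lbar T S l = vcomp (hcomp (mtb S) (mmu T))
  (vcomp (hcomp l (mtb T)) (hcomp (meta T) (hcomp (mtb S) (mtb T)))).
Proof. derive (Bd' 0 1) [:: fwd (Bd 0 1); fwd (A4r 0 1)] [:: fwd (A3r 0 1)]. Qed.

Lemma wdl_etaS : vcomp l (hcomp (mtb T) (meta S))
  = vcomp (lbar T S l) (hcomp (meta S) (mtb T)).
Proof. derive (A4 0 1) (@nil step) [:: fwd (Bd 0 1); fwd (UL 0)]. Qed.

Lemma lbar_muS : vcomp (lbar T S l) (hcomp (mmu S) (mtb T))
  = vcomp (hcomp (mmu S) (mtb T)) (hcomp (mtb S) (lbar T S l)).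
Proof. derive (BL 0 1) [:: fwd (Bd 0 1); fwd (As 0)] [:: fwd (Bd 0 1)]. Qed.

Lemma lbar_muT : vcomp (lbar T S l) (hcomp (mtb S) (mmu T))
  = vcomp (hcomp (mtb S) (mmu T)) (hcomp (lbar T S l) (mtb T)).
Proof.
derive (BR 0 1) [:: fwd (Bd 0 1); fwd (A4r 0 1)] [:: fwd (Bd 0 1); fwd (A4r 0 1); fwd (As 1)].
Qed.

Lemma lbar_law : vcomp (lbar T S l) l = l.
Proof. derive (BA 0 1) [:: fwd (Bd 0 1); bwd (A2 0 1); fwd (UR 0)] (@nil step). Qed.

(** [A2] read backwards merges the two laws into one, which is crossed by the product of the two
    units. *)
Lemma lbar_idem : vcomp (lbar T S l) (lbar T S l) = lbar T S l.
Proof.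
derive (BB 0 1) [:: fwd (Bd 0 1); fwd (Bd 0 1); fwd (As 0); bwd (A2 0 1); fwd (UL 0)]
  [:: fwd (Bd 0 1)].
Qed.

(** The unit hidden in the idempotent is merged by [A2] with the strand [s] that crosses anyway, and
    disappears. *)
Lemma law_muS_lbar :
  vcomp (hcomp (mmu S) (mtb T)) (vcomp (hcomp (mtb S) l) (hcomp (lbar T S l) (mtb S)))
  = vcomp (hcomp (mmu S) (mtb T)) (hcomp (mtb S) l).
Proof.
derive (BM 0 1) [:: fwd (Bd 0 1); fwd (As 0); bwd (A2 0 1); fwd (UL 0)] (@nil step).
Qed.

(** The mirror image of [law_muS_lbar]. Among the basic rules only [Bd] describes the idempotent, so
    [A4r] and then [A3r] backwards first turn it into the other formula. *)
Lemma law_muT_lbar :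
  vcomp (hcomp (mtb S) (mmu T)) (vcomp (hcomp l (mtb T)) (hcomp (mtb T) (lbar T S l)))
  = vcomp (hcomp (mtb S) (mmu T)) (hcomp l (mtb T)).
Proof.
derive (MB 0 1) [:: fwd (Bd 0 1); fwd (A4r 0 1); bwd (A3r 0 1); bwd (As 1); bwd (A1 0 1);
  fwd (UR 1)] (@nil step).
Qed.

End Derived.

Lemma any_ruleP a b (K : TwoCat) (A : Obj K) (X : wdl0 A) v vb xi :
  diag_env a b X v vb xi -> forall r, any_rule a b r -> valid X vb xi r.
Proof.
move=> env r /orP[|]; first exact: (basic_ruleP env).
have H i j (ok : okL a b i j) : [/\ is_bmonad (ws X i), is_bmonad (ws X j)
    & is_wdl (ws X j) (ws X i) (wl X i j)].
  have [oi oj] := okL_okM ok.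
  by split; [apply: (env_monad env) | apply: (env_monad env) | apply: (env_law env)].
case: r => //= i j /H[mi mj lij]; rewrite /valid /=.
- exact: wdl_etaT.
- exact: wdl_etaS.
- exact: lbar_def'.
- exact: lbar_muS.
- exact: lbar_muT.
- exact: lbar_law.
- exact: lbar_idem.
- exact: law_muS_lbar.
exact: law_muT_lbar.
Qed.

(** The checker proves equations of 2-cells only; the sources and targets required by [bcell] are
    read off the boundary words. *)
Lemma env_typing a b (K : TwoCat) (A : Obj K) (X : wdl0 A) v vb xi t :
  diag_env a b X v vb xi -> tok (okS a b) (okG a b) t ->
  src (teval X vb xi t) = wh X v (tsrc t) /\ tgt (teval X vb xi t) = wh X v (ttgt t).
Proof.
move=> env /(tokP (env_strand env) (env_gen env))[st _ w e <-].
by have [-> -> _ _] := dcP (env_strand env) (env_gen env) st w; rewrite e.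
Qed.

Ltac typing_by X vb xi env :=
  lazymatch goal with
  | |- src ?t = _ =>
    let t' := reify X vb xi t in
    refine (etrans (proj1 (env_typing (t := t') env _)) _)
  | |- tgt ?t = _ =>
    let t' := reify X vb xi t in
    refine (etrans (proj2 (env_typing (t := t') env _)) _)
  (* A word evaluates to a right-nested composite ending in [id1]; strictness restores the
     bracketing of the goal. *)
  end; [vm_compute; reflexivity | by rewrite /= ?comp1_id1r ?comp1A].

(** * Weak wreath products *)

Section TwoMonads.
Variables (K : TwoCat) (A : Obj K) (X : wdl0 A).
Hypothesis XP : is_wdl0 1 X.

Let env := wdl0_env (n := 1) isT XP.
Local Ltac diagram ss1 ss2 :=
  diagram_by 2 0 X (id1 A) (id2 (id1 A)) (@xi0 K A) env (any_ruleP env) ss1 ss2.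
Local Ltac typing := typing_by X (id2 (id1 A)) (@xi0 K A) env.

(** Once the idempotent is absorbed by [BM] and [MB], associativity follows from [A1] and [A2] as
    for an ordinary distributive law. The two unit axioms produce the two formulas for the
    idempotent. *)
Lemma is_bmonad_wreath01 : is_bmonad (wreath (ws X 1) (ws X 0) (wl X 0 1)).
Proof.
split.
- split; [typing | typing |].
  diagram [:: fwd (BB 0 1)] (@nil step).
- split; [typing | typing | |].
    diagram [:: fwd (BL 0 1); fwd (BR 0 1); fwd (BA 0 1)] (@nil step).
  diagram [:: fwd (BM 0 1)] [:: bwd (MB 0 1)].
- split; [typing | typing | |].
    diagram [:: fwd (BA 0 1)] (@nil step).
  diagram (@nil step) (@nil step).
- diagram [:: fwd (MB 0 1); fwd (As 0); fwd (A1 0 1)] [:: fwd (BM 0 1);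
    bwd (As 1); fwd (A2 0 1)].
split.
  diagram [:: bwd (A1 0 1); fwd (UR 1)] [:: fwd (Bd 0 1); bwd (BM 0 1)].
diagram [:: bwd (A2 0 1); fwd (UL 0); fwd (MB 0 1)] [:: fwd (Bd' 0 1)].
Qed.

End TwoMonads.

Section ThreeMonads.
Variables (K : TwoCat) (A : Obj K) (X : wdl0 A).
Hypothesis XP : is_wdl0 2 X.

Let env := wdl0_env (n := 2) isT XP.
Local Ltac diagram ss1 ss2 :=
  diagram_by 3 0 X (id1 A) (id2 (id1 A)) (@xi0 K A) env (any_ruleP env) ss1 ss2.
Local Ltac typing := typing_by X (id2 (id1 A)) (@xi0 K A) env.
Local Notation s := (ws X).
Local Notation l := (wl X).
Local Notation W01 := (wreath (s 1) (s 0) (l 0 1)).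
Local Notation W12 := (wreath (s 2) (s 1) (l 1 2)).
Local Notation l01_2 := (law_wreathl (s 0) (s 1) (s 2) (l 0 1) (l 0 2) (l 1 2)).
Local Notation l0_12 := (law_wreathr (s 0) (s 1) (s 2) (l 0 1) (l 0 2) (l 1 2)).

Lemma is_wdl_wreath01_2 : is_wdl (s 2) W01 l01_2.
Proof.
split.
- split; [typing | typing | |].
    (* A device that recurs below. The idempotent on the input is expanded by [Bd] and its
       multiplication carried across by [A2]; after [BL] and [YB] backwards the idempotent on the
       output meets the law [l 0 1] and is absorbed by [BA]. *)
    diagram [:: fwd (Bd 0 1); fwd (A2 0 2); fwd (BL 0 1); bwd (YB 0 1 2);
    fwd (BA 0 1)] [:: fwd (Bd 0 1); fwd (A2 0 2); bwd (YB 0 1 2)].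
  diagram [:: fwd (BB 0 1)] (@nil step).
- diagram [:: (Bd' 0 1, false, 1); fwd (A2 1 2); bwd (YB 0 1 2); fwd (A4 1 2);
    fwd (BR 1 2)] [:: (Bd' 0 1, false, 1); fwd (A2 1 2); bwd (A1 1 2);
    bwd (YB 0 1 2); bwd (A1 0 2); fwd (BR 0 1); fwd (BA 0 1); fwd (A4 1 2)].
- diagram [:: fwd (BL 0 1); fwd (BR 0 1); fwd (BA 0 1); bwd (MB 0 1)]
    [:: fwd (BB 0 1); fwd (BM 0 1); fwd (YB 0 1 2); bwd (A2 0 2); fwd (BM 0 1);
    bwd (A2 1 2)].
- diagram [:: fwd (BB 0 1); fwd (A3 0 2); fwd (Bd 0 1); fwd (BL 0 2)]
    [:: fwd (BA 0 1); fwd (BB 0 1); fwd (BB 0 1); fwd (BM 0 1); bwd (YB 0 1 2);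
    bwd (A1 0 1); bwd (Bd 1 2); bwd (A3 1 2); fwd (YB 0 1 2); fwd (A3 0 2)].
diagram [:: fwd (BA 0 1); bwd (YB 0 1 2); fwd (A4 1 2); fwd (Bd' 1 2);
    fwd (A1 0 2)] [:: fwd (BA 0 1); fwd (BA 0 1); bwd (YB 0 1 2); fwd (BA 0 1);
    bwd (MB 0 2); bwd (A4 0 2)].
Qed.

(** Same method as for [is_wdl_wreath01_2], with strand 0 crossing from the other side: [A1] takes
    the place of [A2], and [YB] is read in the opposite direction. *)
Lemma is_wdl_0_wreath12 : is_wdl W12 (s 0) l0_12.
Proof.
split.
- split; [typing | typing | |].
    diagram [:: fwd (Bd 1 2); fwd (A1 0 1); fwd (YB 0 1 2); fwd (BL 1 2);
    fwd (BA 1 2)] [:: fwd (Bd 1 2); fwd (A1 0 1); fwd (YB 0 1 2)].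
  diagram [:: fwd (BB 1 2)] (@nil step).
- diagram [:: fwd (BL 1 2); fwd (BR 1 2); fwd (BA 1 2); bwd (BM 1 2)]
    [:: fwd (BB 1 2); fwd (MB 1 2); bwd (YB 0 1 2); bwd (A1 0 1); bwd (A1 0 2);
    fwd (MB 1 2)].
- diagram [:: (Bd 1 2, false, 1); fwd (A1 0 1); fwd (YB 0 1 2); fwd (A3 0 1);
    fwd (BL 0 1)] [:: (Bd 1 2, false, 1); fwd (A1 0 1); bwd (A2 0 1);
    fwd (YB 0 1 2); bwd (A2 0 2); fwd (BL 1 2); fwd (BA 1 2); fwd (A3 0 1)].
- diagram [:: fwd (BA 1 2); fwd (YB 0 1 2); fwd (A3 0 1); fwd (Bd 0 1);
    fwd (A2 0 2)] [:: fwd (BA 1 2); fwd (BA 1 2); fwd (YB 0 1 2); fwd (BA 1 2);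
    bwd (BM 0 2); bwd (A3 0 2)].
diagram [:: fwd (BB 1 2); fwd (A4 0 2); fwd (Bd' 1 2); fwd (BR 0 2)]
    [:: fwd (BA 1 2); fwd (BB 1 2); fwd (BB 1 2); fwd (MB 1 2); fwd (YB 0 1 2);
    bwd (A2 1 2); bwd (Bd' 0 1); bwd (A4 0 1); bwd (YB 0 1 2); fwd (A4 0 2)].
Qed.

Lemma lbar_wreathA : lbar (s 2) W01 l01_2 = lbar W12 (s 0) l0_12.
Proof.
diagram [:: fwd (BA 0 1); fwd (BB 0 1); fwd (BM 0 1)] [:: fwd (BB 1 2);
    fwd (Bd 1 2); fwd (A1 0 1); fwd (YB 0 1 2); fwd (BL 1 2); fwd (BA 1 2)].
Qed.

(** The 1-cells agree by strict associativity and the idempotents by [lbar_wreathA]; multiplications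
    and units agree through the Yang-Baxter relation. *)
Lemma wreath012A : wreath (s 2) W01 l01_2 = wreath W12 (s 0) l0_12.
Proof.
rewrite /wreath lbar_wreathA; congr BMonad; first by rewrite /= comp1A.
  change (mmu (wreath (s 2) W01 l01_2) = mmu (wreath W12 (s 0) l0_12)).
  diagram [:: fwd (BM 0 1); fwd (Bd' 0 1); fwd (A2 1 2); bwd (As 1)]
    [:: fwd (MB 1 2); fwd (Bd 1 2); fwd (A1 0 1); fwd (YB 0 1 2)].
change (meta (wreath (s 2) W01 l01_2) = meta (wreath W12 (s 0) l0_12)).
diagram [:: fwd (BA 0 1); bwd (YB 0 1 2)] [:: fwd (BA 1 2)].
Qed.

End ThreeMonads.

Section FourMonads.
Variables (K : TwoCat) (A : Obj K) (X : wdl0 A).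
Hypothesis XP : is_wdl0 3 X.

Let env := wdl0_env (n := 3) isT XP.
Local Ltac diagram ss1 ss2 :=
  diagram_by 4 0 X (id1 A) (id2 (id1 A)) (@xi0 K A) env (any_ruleP env) ss1 ss2.
Local Notation s := (ws X).
Local Notation l := (wl X).
Local Notation W i j := (wreath (s j) (s i) (l i j)).
Local Notation lwl i j k :=
  (law_wreathl (s i) (s j) (s k) (l i j) (l i k) (l j k)).
Local Notation lwr i j k :=
  (law_wreathr (s i) (s j) (s k) (l i j) (l i k) (l j k)).

Definition yang_baxter (S0 S1 S2 : bmonad A) (l01 l02 l12 : Cell A A) :=
  vcomp (hcomp l01 (mtb S2)) (vcomp (hcomp (mtb S1) l02) (hcomp l12 (mtb S0)))
  = vcomp (hcomp (mtb S0) l12) (vcomp (hcomp l02 (mtb S1)) (hcomp (mtb S2) l01)).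

(** The product formed by [C_k] can stand in any of the three places of a Yang-Baxter relation;
    hence this lemma and the next two. *)
Lemma yang_baxter_01_2_3 :
  yang_baxter (W 0 1) (s 2) (s 3) (lwl 0 1 2) (lwl 0 1 3) (l 2 3).
Proof.
rewrite /yang_baxter.
diagram [:: fwd (BB 0 1); fwd (Bd 0 1); fwd (A2 0 3); fwd (BL 0 1);
    bwd (YB 0 1 3); fwd (BA 0 1); fwd (A2 0 2); bwd (YB 0 1 2); fwd (YB 0 2 3);
    fwd (YB 1 2 3)] [:: fwd (Bd 0 1); fwd (A2 0 2); fwd (BL 0 1);
    bwd (YB 0 1 2); fwd (BA 0 1); fwd (A2 0 3); fwd (BL 0 1); bwd (YB 0 1 3);
    fwd (BA 0 1); bwd (YB 0 2 3)].
Qed.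

Lemma yang_baxter_0_12_3 :
  yang_baxter (s 0) (W 1 2) (s 3) (lwr 0 1 2) (l 0 3) (lwl 1 2 3).
Proof.
rewrite /yang_baxter.
diagram [:: fwd (BB 1 2); fwd (Bd 1 2); fwd (A2 1 3); fwd (BL 1 2);
    bwd (YB 1 2 3); fwd (BA 1 2); fwd (YB 1 2 3); bwd (A2 1 3); fwd (YB 0 2 3)]
    [:: fwd (BB 1 2); fwd (Bd 1 2); fwd (A1 0 1); fwd (YB 0 1 2); fwd (BL 1 2);
    fwd (BA 1 2); bwd (YB 0 1 2); bwd (A1 0 1); bwd (YB 0 1 3)].
Qed.

Lemma yang_baxter_0_1_23 :
  yang_baxter (s 0) (s 1) (W 2 3) (l 0 1) (lwr 0 2 3) (lwr 1 2 3).
Proof.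
rewrite /yang_baxter.
diagram [:: fwd (Bd 2 3); fwd (A1 1 2); fwd (YB 1 2 3); fwd (BL 2 3);
    fwd (BA 2 3); fwd (A1 0 2); fwd (YB 0 2 3); fwd (BL 2 3); fwd (BA 2 3);
    fwd (YB 0 1 2)] [:: fwd (BB 2 3); fwd (Bd 2 3); fwd (A1 0 2);
    fwd (YB 0 2 3); fwd (BL 2 3); fwd (BA 2 3); fwd (A1 1 2); fwd (YB 1 2 3);
    bwd (YB 0 1 2); bwd (YB 0 1 3)].
Qed.

(** Needed for [C_1 C_2 = C_1 C_1] as soon as another monad follows the three that are merged. *)
Lemma law_wreath012_3 :
  law_wreathl (W 0 1) (s 2) (s 3) (lwl 0 1 2) (lwl 0 1 3) (l 2 3)
  = law_wreathl (s 0) (W 1 2) (s 3) (lwr 0 1 2) (l 0 3) (lwl 1 2 3).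
Proof.
diagram [:: fwd (BA 0 1); fwd (BB 0 1); fwd (BM 0 1); bwd (YB 0 1 2);
    bwd (A1 0 1); bwd (Bd 1 2); fwd (BL 0 1); fwd (BA 0 1); fwd (A2 0 3);
    fwd (BL 0 1); bwd (YB 0 1 3); fwd (BA 0 1); fwd (YB 0 1 3); bwd (A2 0 3);
    fwd (Bd 1 2)] [:: fwd (BB 1 2); fwd (BB 1 2); fwd (BB 1 2); fwd (Bd 1 2);
    fwd (A1 0 1); fwd (YB 0 1 2); fwd (BL 1 2); fwd (BA 1 2); bwd (YB 0 1 2);
    bwd (A1 0 1)].
Qed.

(** Merging 0, 1 or 2, 3 first gives different formulas for the law between the two products; this
    is the one equation of diagrams behind the commutation of disjoint merges. *)
Lemma law_wreath01_23 :
  law_wreathl (s 0) (s 1) (W 2 3) (l 0 1) (lwr 0 2 3) (lwr 1 2 3)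
  = law_wreathr (W 0 1) (s 2) (s 3) (lwl 0 1 2) (lwl 0 1 3) (l 2 3).
Proof.
diagram [:: fwd (BB 2 3); fwd (Bd 2 3); fwd (A1 0 2); fwd (YB 0 2 3);
    fwd (BL 2 3); fwd (BA 2 3); bwd (YB 0 2 3); bwd (A1 0 2); fwd (Bd 0 1)]
    [:: fwd (BB 0 1); fwd (Bd 0 1); fwd (A2 0 3); fwd (BL 0 1); bwd (YB 0 1 3);
    fwd (BA 0 1); fwd (YB 0 1 3); bwd (A2 0 3); fwd (Bd 2 3)].
Qed.

End FourMonads.

(* A 1-cell with object A = B: its source monads are 0, 1, 2 and its target
   monads are 4, 5, 6. *)
Section TwoMonads1.
Variables (K : TwoCat) (A : Obj K) (X : wdl0 A).
Variables (v : Hom A A) (vb : Cell A A) (xi : nat -> Cell A A).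
Hypothesis env : diag_env 2 2 X v vb xi.

Local Ltac diagram ss1 ss2 :=
  diagram_by 2 2 X v vb xi env (any_ruleP env) ss1 ss2.
Local Ltac typing := typing_by X vb xi env.
Local Notation s := (ws X).
Local Notation l := (wl X).

Lemma is_mnd1_wreath01 :
  is_mnd1 (wreath (s 1) (s 0) (l 0 1)) (wreath (s 5) (s 4) (l 4 5)) v vb
    (xi_wreath (s 0) (s 1) (s 4) (l 0 1) vb (xi 0) (xi 1)).
Proof.
split.
- split; [typing | typing | |].
    diagram [:: fwd (BB 0 1)] (@nil step).
  diagram [:: fwd (Bd' 4 5); fwd (XM 1); fwd (BR 0 1)] [:: fwd (Bd' 0 1);
    bwd (XE 1); fwd (XL 0 1)].
- diagram [:: fwd (XM 1); fwd (BR 0 1); bwd (BM 4 5); fwd (XM 0); fwd (BL 0 1)]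
    [:: fwd (BB 0 1); fwd (MB 0 1); fwd (BM 0 1); fwd (XL 0 1)].
diagram [:: bwd (XL 0 1); fwd (XE 0)] [:: bwd (XE 1)].
Qed.

End TwoMonads1.

Section ThreeMonads1.
Variables (K : TwoCat) (A : Obj K) (X : wdl0 A).
Variables (v : Hom A A) (vb : Cell A A) (xi : nat -> Cell A A).
Hypothesis env : diag_env 3 3 X v vb xi.

Local Ltac diagram ss1 ss2 :=
  diagram_by 3 3 X v vb xi env (any_ruleP env) ss1 ss2.
Local Notation s := (ws X).
Local Notation l := (wl X).
Local Notation W i j := (wreath (s j) (s i) (l i j)).
Local Notation lwl i j k :=
  (law_wreathl (s i) (s j) (s k) (l i j) (l i k) (l j k)).
Local Notation lwr i j k :=
  (law_wreathr (s i) (s j) (s k) (l i j) (l i k) (l j k)).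
Local Notation xi01 := (xi_wreath (s 0) (s 1) (s 4) (l 0 1) vb (xi 0) (xi 1)).
Local Notation xi12 := (xi_wreath (s 1) (s 2) (s 5) (l 1 2) vb (xi 1) (xi 2)).

Lemma wdl1_wreath01_2 :
  vcomp (hcomp vb (lwl 0 1 2))
    (vcomp (hcomp (xi 2) (mtb (W 0 1))) (hcomp (mtb (s 6)) xi01))
  = vcomp (hcomp vb (lbar (s 2) (W 0 1) (lwl 0 1 2)))
      (vcomp (hcomp xi01 (mtb (s 2)))
        (vcomp (hcomp (mtb (W 4 5)) (xi 2)) (hcomp (lwl 4 5 6) vb))).
Proof.
(* The run [Bd 4 5], [XM 0], [BL 0 1], [XL 0 1] backwards, [XE 0] occurs twice: across the 1-cell,
   it absorbs the idempotent of the target pair 4, 5 into that of the source pair 0, 1. *)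
diagram [:: fwd (BB 0 1); fwd (BB 0 1); fwd (Bd 0 1)] [:: fwd (BB 0 1);
    fwd (BB 0 1); fwd (BA 0 1); bwd (YB 0 1 2); bwd (A1 0 1); bwd (Bd 1 2);
    (Bd 4 5, false, 1); fwd (XM 0); fwd (BL 0 1); bwd (XL 0 1); fwd (XE 0);
    bwd (Bd 0 1); fwd (Bd 1 2); fwd (A1 0 1); fwd (BM 0 1); bwd (A1 0 1);
    bwd (Bd 1 2); bwd (XL 1 2); fwd (YB 0 1 2); bwd (BM 0 2); bwd (XL 0 2);
    bwd (A2 0 2); bwd (Bd 0 1); fwd (Bd 4 5); fwd (XM 0); fwd (BL 0 1);
    bwd (XL 0 1); fwd (XE 0)].
Qed.

Lemma wdl1_0_wreath12 :
  vcomp (hcomp vb (lwr 0 1 2))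
    (vcomp (hcomp xi12 (mtb (s 0))) (hcomp (mtb (W 5 6)) (xi 0)))
  = vcomp (hcomp vb (lbar (W 1 2) (s 0) (lwr 0 1 2)))
      (vcomp (hcomp (xi 0) (mtb (W 1 2)))
        (vcomp (hcomp (mtb (s 4)) xi12) (hcomp (lwr 4 5 6) vb))).
Proof.
diagram [:: fwd (BB 1 2)] [:: fwd (BB 1 2); fwd (BB 1 2); fwd (BB 1 2);
    fwd (A4 0 2); fwd (Bd' 1 2); fwd (BR 0 2); bwd (A4 0 2); fwd (YB 0 1 2);
    fwd (BR 1 2); fwd (BA 1 2); fwd (A3 0 2); bwd (BL 0 2); bwd (Bd 0 1);
    bwd (A3 0 2); bwd (BB 0 1); bwd (XL 0 1); fwd (BA 0 1); bwd (YB 0 1 2);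
    bwd (MB 0 2); bwd (XL 0 2); bwd (A1 0 2); bwd (Bd' 1 2)].
Qed.

Lemma xi_wreath012A :
  xi_wreath (W 0 1) (s 2) (W 4 5) (lwl 0 1 2) vb xi01 (xi 2)
  = xi_wreath (s 0) (W 1 2) (s 4) (lwr 0 1 2) vb (xi 0) xi12.
Proof.
diagram [:: fwd (BA 0 1); fwd (BB 0 1); fwd (BB 0 1); bwd (YB 0 1 2);
    bwd (A1 0 1); bwd (Bd 1 2); fwd (Bd 4 5); fwd (XM 0); fwd (BL 0 1);
    bwd (XL 0 1); fwd (XE 0); bwd (Bd 0 1); fwd (Bd' 0 1); fwd (BL 1 2)]
    [:: fwd (BB 1 2); fwd (BB 1 2); fwd (BB 1 2); fwd (Bd 1 2); fwd (A1 0 1);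
    fwd (YB 0 1 2); fwd (BL 1 2); fwd (BA 1 2); bwd (YB 0 1 2); bwd (A1 0 1);
    bwd (Bd 1 2); bwd (BM 0 1); fwd (Bd' 0 1)].
Qed.

End ThreeMonads1.

(** * The linking 2-category of two objects *)

(* Endo-1-cells of A and of B are paired, and a third kind of 1-cell goes from
   A to B; composites that make no sense are [LZ].  This puts a 1-cell and the
   monads on its source and on its target in a 2-category with one object. *)
Inductive link (T U W : Type) := LD of T & U | LV of W | LZ.
Arguments LD {T U W}.
Arguments LV {T U W}.
Arguments LZ {T U W}.

Section Linking.
Variables (K : TwoCat) (A B : Obj K).

Definition link_hom := link (@Hom K A A) (@Hom K B B) (@Hom K A B).
Definition link_cell := link (@Cell K A A) (@Cell K B B) (@Cell K A B).

(** Pairs, unlike a disjoint union, provide an identity [LD (id1 A) (id1 B)] that is a unit on both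
    sides of an [LV]; an [LV] sees the [B] component on its left and the [A] component on its
    right. *)
Definition link_comp1 (x y : link_hom) : link_hom := match x, y with
  | LD a b, LD a' b' => LD (comp1 a a') (comp1 b b')
  | LD _ b, LV c => LV (comp1 b c) | LV c, LD a _ => LV (comp1 c a)
  | _, _ => LZ end.

Definition link_hcomp (x y : link_cell) : link_cell := match x, y with
  | LD a b, LD a' b' => LD (hcomp a a') (hcomp b b')
  | LD _ b, LV c => LV (hcomp b c) | LV c, LD a _ => LV (hcomp c a)
  | _, _ => LZ end.

Definition link_vcomp (x y : link_cell) : link_cell := match x, y with
  | LD a b, LD a' b' => LD (vcomp a a') (vcomp b b')
  | LV c, LV c' => LV (vcomp c c') | _, _ => LZ end.

Definition link_src (x : link_cell) : link_hom := match x with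
  | LD a b => LD (src a) (src b) | LV c => LV (src c) | LZ => LZ end.
Definition link_tgt (x : link_cell) : link_hom := match x with
  | LD a b => LD (tgt a) (tgt b) | LV c => LV (tgt c) | LZ => LZ end.
Definition link_id2 (x : link_hom) : link_cell := match x with
  | LD a b => LD (id2 a) (id2 b) | LV c => LV (id2 c) | LZ => LZ end.

(** Kept transparent, so that its compositions reduce to those of [K]. *)
Definition link_cat : TwoCat.
Proof.
refine (@Build_TwoCat unit (fun _ _ => link_hom) (fun _ _ => link_cell)
  (fun _ => LD (id1 A) (id1 B)) (fun _ _ _ => link_comp1) (fun _ _ => link_src)
  (fun _ _ => link_tgt) (fun _ _ => link_id2) (fun _ _ => link_vcomp)
  (fun _ _ _ => link_hcomp) _ _ _ _ _ _ _ _ _ _ _ _ _ _ _ _ _).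
- by move=> _ _ _ _ [a b|c|] [a' b'|c'|] [a'' b''|c''|] //=; rewrite !comp1A.
- by move=> _ _ [a b|c|] //=; rewrite !comp1_id1l.
- by move=> _ _ [a b|c|] //=; rewrite !comp1_id1r.
- by move=> _ _ [a b|c|] //=; rewrite !src_id2.
- by move=> _ _ [a b|c|] //=; rewrite !tgt_id2.
- by move=> _ _ [a b|c|] [a' b'|c'|] //= [] *; rewrite !src_vcomp.
- by move=> _ _ [a b|c|] [a' b'|c'|] //= [] *; rewrite !tgt_vcomp.
- by move=> _ _ _ [a b|c|] [a' b'|c'|] //=; rewrite !src_hcomp.
- by move=> _ _ _ [a b|c|] [a' b'|c'|] //=; rewrite !tgt_hcomp.
- move=> _ _ [a b|c|] [a' b'|c'|] [a'' b''|c''|] //= e e';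
    by case: e => *; case: e' => *; rewrite !vcompA.
- by move=> _ _ [a b|c|] //=; rewrite !vcomp_id2l.
- by move=> _ _ [a b|c|] //=; rewrite !vcomp_id2r.
- by move=> _ _ _ _ [a b|c|] [a' b'|c'|] [a'' b''|c''|] //=; rewrite !hcompA.
- by move=> _ _ [a b|c|] //=; rewrite !hcomp_id1l.
- by move=> _ _ [a b|c|] //=; rewrite !hcomp_id1r.
- by move=> _ _ _ [a b|c|] [a' b'|c'|] //=; rewrite !hcomp_id2.
move=> _ _ _ [a b|c|] [a' b'|c'|] [x y|z|] [x' y'|z'|] //= e e';
  by case: e => *; case: e' => *; rewrite !Defs.interchange.
Defined.

Local Notation LC := (@Cell link_cat tt tt).
Local Notation LH := (@Hom link_cat tt tt).
Local Notation idA := (id2 (id1 A)).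
Local Notation idB := (id2 (id1 B)).

Definition linkA (M : bmonad A) : @bmonad link_cat tt :=
  @BMonad link_cat tt (LD (mt M) (id1 B)) (LD (mtb M) idB) (LD (mmu M) idB)
    (LD (meta M) idB).
Definition linkB (M : bmonad B) : @bmonad link_cat tt :=
  @BMonad link_cat tt (LD (id1 A) (mt M)) (LD idA (mtb M)) (LD idA (mmu M))
    (LD idA (meta M)).
Definition cellA (a : @Cell K A A) : LC := LD a idB.
Definition cellB (b : @Cell K B B) : LC := LD idA b.
Definition cellV (c : @Cell K A B) : LC := LV c.

Lemma vcomp_id1 C : vcomp (id2 (id1 C)) (id2 (id1 C)) = id2 (id1 C) :> @Cell K C C.
Proof. by case: (@idem_id2 K C C (id1 C)). Qed.

Lemma hcomp_id1 C : hcomp (id2 (id1 C)) (id2 (id1 C)) = id2 (id1 C) :> @Cell K C C.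
Proof. exact: hcomp_id1l. Qed.

Lemma vcompAA a a' : vcomp (cellA a) (cellA a') = cellA (vcomp a a').
Proof. by rewrite /vcomp /= vcomp_id1. Qed.
Lemma hcompAA a a' : hcomp (cellA a) (cellA a') = cellA (hcomp a a').
Proof. by rewrite /hcomp /= hcomp_id1. Qed.
Lemma vcompBB b b' : vcomp (cellB b) (cellB b') = cellB (vcomp b b').
Proof. by rewrite /vcomp /= vcomp_id1. Qed.
Lemma hcompBB b b' : hcomp (cellB b) (cellB b') = cellB (hcomp b b').
Proof. by rewrite /hcomp /= hcomp_id1. Qed.
Lemma vcompVV c c' : vcomp (cellV c) (cellV c') = cellV (vcomp c c').
Proof. by []. Qed.
Lemma hcompBV b c : hcomp (cellB b) (cellV c) = cellV (hcomp b c).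
Proof. by []. Qed.
Lemma hcompVA c a : hcomp (cellV c) (cellA a) = cellV (hcomp c a).
Proof. by []. Qed.

Definition linkE :=
  (vcompAA, hcompAA, vcompBB, hcompBB, vcompVV, hcompBV, hcompVA).

Lemma mtbA M : mtb (linkA M) = cellA (mtb M). Proof. by []. Qed.
Lemma mmuA M : mmu (linkA M) = cellA (mmu M). Proof. by []. Qed.
Lemma metaA M : meta (linkA M) = cellA (meta M). Proof. by []. Qed.
Lemma mtbB M : mtb (linkB M) = cellB (mtb M). Proof. by []. Qed.
Lemma mmuB M : mmu (linkB M) = cellB (mmu M). Proof. by []. Qed.
Lemma metaB M : meta (linkB M) = cellB (meta M). Proof. by []. Qed.

Definition link_monadE := (mtbA, mmuA, metaA, mtbB, mmuB, metaB).

Lemma lbarA T S l : lbar (linkA T) (linkA S) (cellA l) = cellA (lbar T S l).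
Proof. by rewrite /lbar !link_monadE !linkE. Qed.
Lemma lbarB T S l : lbar (linkB T) (linkB S) (cellB l) = cellB (lbar T S l).
Proof. by rewrite /lbar !link_monadE !linkE. Qed.

Lemma comp1AA u w :
  @comp1 link_cat tt tt tt (LD u (id1 B)) (LD w (id1 B)) = LD (comp1 u w) (id1 B).
Proof. by rewrite /comp1 /= comp1_id1l. Qed.
Lemma comp1BB u w :
  @comp1 link_cat tt tt tt (LD (id1 A) u) (LD (id1 A) w) = LD (id1 A) (comp1 u w).
Proof. by rewrite /comp1 /= comp1_id1l. Qed.

Lemma wreathA T S l : wreath (linkA T) (linkA S) (cellA l) = linkA (wreath T S l).
Proof.
by rewrite /wreath lbarA !link_monadE !linkE; congr BMonad; apply: comp1AA.
Qed.
Lemma wreathB T S l : wreath (linkB T) (linkB S) (cellB l) = linkB (wreath T S l).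
Proof.
by rewrite /wreath lbarB !link_monadE !linkE; congr BMonad; apply: comp1BB.
Qed.

Lemma bcellA u ub u' ub' a : bcell u ub u' ub' a ->
  @bcell link_cat tt tt (LD u (id1 B)) (cellA ub) (LD u' (id1 B)) (cellA ub') (cellA a).
Proof.
by case=> e1 e2 e3 e4; split; rewrite ?linkE ?e3 ?e4 // /cellA /= ?src_id2 ?tgt_id2 ?e1 ?e2.
Qed.
Lemma bcellB u ub u' ub' b : bcell u ub u' ub' b ->
  @bcell link_cat tt tt (LD (id1 A) u) (cellB ub) (LD (id1 A) u') (cellB ub') (cellB b).
Proof.
by case=> e1 e2 e3 e4; split; rewrite ?linkE ?e3 ?e4 // /cellB /= ?src_id2 ?tgt_id2 ?e1 ?e2.
Qed.

Lemma idemA u ub : idem u ub -> @idem link_cat tt tt (LD u (id1 B)) (cellA ub).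
Proof. by move/bcell_id/bcellA; case. Qed.
Lemma idemB u ub : idem u ub -> @idem link_cat tt tt (LD (id1 A) u) (cellB ub).
Proof. by move/bcell_id/bcellB; case. Qed.

Lemma is_bmonadA M : is_bmonad M -> is_bmonad (linkA M).
Proof.
case=> h1 h2 h3 h4 [h5 h6]; rewrite /is_bmonad !link_monadE !linkE h4 h5 h6.
split=> //; first exact: idemA; last exact: bcellA h3.
by rewrite comp1AA; apply: bcellA.
Qed.
Lemma is_bmonadB M : is_bmonad M -> is_bmonad (linkB M).
Proof.
case=> h1 h2 h3 h4 [h5 h6]; rewrite /is_bmonad !link_monadE !linkE h4 h5 h6.
split=> //; first exact: idemB; last exact: bcellB h3.
by rewrite comp1BB; apply: bcellB.
Qed.

Lemma is_wdlA T S l : is_wdl T S l -> is_wdl (linkA T) (linkA S) (cellA l).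
Proof.
case=> h1 h2 h3 h4 h5; rewrite /is_wdl !link_monadE !linkE h2 h3 h4 h5.
by split=> //; rewrite !comp1AA; apply: bcellA.
Qed.
Lemma is_wdlB T S l : is_wdl T S l -> is_wdl (linkB T) (linkB S) (cellB l).
Proof.
case=> h1 h2 h3 h4 h5; rewrite /is_wdl !link_monadE !linkE h2 h3 h4 h5.
by split=> //; rewrite !comp1BB; apply: bcellB.
Qed.

Lemma cellV_inj : injective cellV. Proof. by move=> c c' []. Qed.

Lemma bcellV u ub u' ub' c : bcell u ub u' ub' c <->
  @bcell link_cat tt tt (LV u) (cellV ub) (LV u') (cellV ub') (cellV c).
Proof.
split=> [] [e1 e2 e3 e4]; split; rewrite ?linkE ?e3 ?e4 //.
- by rewrite /src /= e1.
- by rewrite /tgt /= e2.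
- by case: e1.
- by case: e2.
- exact: cellV_inj e3.
exact: cellV_inj e4.
Qed.

(** One direction feeds [link_env], the other brings [is_mnd1_wreath01] back to [K]. *)
Lemma is_mnd1_link M M' v vb x : is_mnd1 M M' v vb x <->
  is_mnd1 (linkA M) (linkB M') (LV v : LH) (cellV vb) (cellV x).
Proof.
rewrite /is_mnd1 !link_monadE !linkE.
split=> [] [/bcellV h1 h2 h3]; split=> //.
- by rewrite h2.
- by rewrite h3.
- exact: cellV_inj h2.
exact: cellV_inj h3.
Qed.

(** * A 1-cell with its source and target families as data for the checker *)

Section LinkFamily.
Variables (X : wdl0 A) (Y : wdl0 B).

Definition linkX : @wdl0 link_cat tt := @WDL0 link_cat tt
  (fun i => if i < 4 then linkA (ws X i) else linkB (ws Y (i - 4)))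
  (fun i j => if i < 4 then cellA (wl X i j) else cellB (wl Y (i - 4) (j - 4))).

Lemma linkX_wsA i : i < 4 -> ws linkX i = linkA (ws X i).
Proof. by move=> h; rewrite /= h. Qed.
Lemma linkX_wlA i j : i < 4 -> wl linkX i j = cellA (wl X i j).
Proof. by move=> h; rewrite /= h. Qed.
Lemma linkX_wsB i : 4 <= i -> ws linkX i = linkB (ws Y (i - 4)).
Proof. by rewrite leqNgt => /negbTE h; rewrite /= h. Qed.
Lemma linkX_wlB i j : 4 <= i -> wl linkX i j = cellB (wl Y (i - 4) (j - 4)).
Proof. by rewrite leqNgt => /negbTE h; rewrite /= h. Qed.

Lemma link_env n (F : wdl1 X Y) : n < 4 -> is_wdl0 n X -> is_wdl0 n Y ->
  is_wdl1 n F ->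
  diag_env n.+1 n.+1 linkX (LV (wv F) : LH) (cellV (wvb F)) (fun i => cellV (wxi F i)).
Proof.
move=> n4 [Xm Xl Xy] [Ym Yl Yy] [Fv Fm Fl].
have lt4 i : i < n.+1 -> i < 4 by rewrite ltnS => /leq_ltn_trans; apply.
have sub4 i : i < n.+1 + 4 -> i - 4 <= n.
  by move=> h; rewrite leq_subLR addnC -ltnS -addSn.
have sub_lt i j : 4 <= i -> i < j -> i - 4 < j - 4.
  by move=> h ij; rewrite ltn_sub2r // (leq_ltn_trans h).
split.
- move=> i /orP[h|/andP[h h']].
    by rewrite linkX_wsA ?lt4 //; apply/is_bmonadA/Xm.
  by rewrite linkX_wsB //; apply/is_bmonadB/Ym/sub4.
- move=> i j /andP[ij /orP[h|/andP[h h']]].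
    have i4 := lt4 _ (ltn_trans ij h).
    by rewrite (linkX_wsA (lt4 _ h)) (linkX_wsA i4) (linkX_wlA _ i4); apply/is_wdlA/Xl.
  have j4 := leq_trans h (ltnW ij).
  rewrite !linkX_wsB // linkX_wlB //.
  by apply/is_wdlB/Yl/sub4; rewrite ?sub_lt.
- move=> i j k /andP[ij hj] /andP[jk hk]; have ik := ltn_trans ij jk.
  case: (ltnP i 4) => i4.
    have {}hj : j < n.+1 by case/orP: hj => // /andP[]; rewrite leqNgt i4.
    have j4 := lt4 _ hj.
    have {}hk : k < n.+1 by case/orP: hk => // /andP[]; rewrite leqNgt j4.
    have k4 := lt4 _ hk; rewrite !linkX_wsA // !linkX_wlA //.
    by rewrite !link_monadE !linkE Xy.
  have j4 := leq_trans i4 (ltnW ij); have k4 := leq_trans j4 (ltnW jk).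
  have {}hk : k < n.+1 + 4.
    by case/orP: hk => [h|/andP[] //]; apply: leq_trans h (leq_addr _ _).
  by rewrite !linkX_wsB // !linkX_wlB // !link_monadE !linkE Yy ?sub_lt ?sub4.
- by have /bcell_id/bcellV[] := Fv; split.
- move=> i /andP[h _]; rewrite linkX_wsA ?lt4 // linkX_wsB ?leq_addl // addnK.
  exact/is_mnd1_link/Fm.
move=> i j /andP[hi _] /andP[hj _] ij.
rewrite !(linkX_wsA (lt4 _ hi)) !(linkX_wsA (lt4 _ hj)) !(linkX_wlA _ (lt4 _ hi)).
rewrite !linkX_wsB ?leq_addl // linkX_wlB ?leq_addl // !addnK lbarA.
by rewrite !link_monadE !linkE Fl.
Qed.

Lemma linkX_wsE :
  (ws linkX 0 = linkA (ws X 0)) * (ws linkX 1 = linkA (ws X 1)) *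
  (ws linkX 2 = linkA (ws X 2)) * (ws linkX 4 = linkB (ws Y 0)) *
  (ws linkX 5 = linkB (ws Y 1)) * (ws linkX 6 = linkB (ws Y 2)).
Proof. by []. Qed.

Lemma linkX_wlE :
  (wl linkX 0 1 = cellA (wl X 0 1)) * (wl linkX 0 2 = cellA (wl X 0 2)) *
  (wl linkX 1 2 = cellA (wl X 1 2)) * (wl linkX 4 5 = cellB (wl Y 0 1)) *
  (wl linkX 4 6 = cellB (wl Y 0 2)) * (wl linkX 5 6 = cellB (wl Y 1 2)).
Proof. by []. Qed.

End LinkFamily.
End Linking.

(** * Wreath products of 1-cells between arbitrary objects *)

Section WreathOneCells.
Variables (K : TwoCat) (A B : Obj K).

Lemma law_wreathlA (S T U : bmonad A) lST lSU lTU :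
  law_wreathl (linkA B S) (linkA B T) (linkA B U) (cellA B lST) (cellA B lSU) (cellA B lTU)
  = cellA B (law_wreathl S T U lST lSU lTU).
Proof. by rewrite /law_wreathl lbarA !link_monadE !linkE. Qed.
Lemma law_wreathlB (S T U : bmonad B) lST lSU lTU :
  law_wreathl (linkB A S) (linkB A T) (linkB A U) (cellB A lST) (cellB A lSU) (cellB A lTU)
  = cellB A (law_wreathl S T U lST lSU lTU).
Proof. by rewrite /law_wreathl lbarB !link_monadE !linkE. Qed.
Lemma law_wreathrA (U S T : bmonad A) lUS lUT lST :
  law_wreathr (linkA B U) (linkA B S) (linkA B T) (cellA B lUS) (cellA B lUT) (cellA B lST)
  = cellA B (law_wreathr U S T lUS lUT lST).
Proof. by rewrite /law_wreathr lbarA !link_monadE !linkE. Qed.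
Lemma law_wreathrB (U S T : bmonad B) lUS lUT lST :
  law_wreathr (linkB A U) (linkB A S) (linkB A T) (cellB A lUS) (cellB A lUT) (cellB A lST)
  = cellB A (law_wreathr U S T lUS lUT lST).
Proof. by rewrite /law_wreathr lbarB !link_monadE !linkE. Qed.
Lemma xi_wreathV (S T : bmonad A) (S' : bmonad B) lST (vb xiS xiT : Cell A B) :
  xi_wreath (linkA B S) (linkA B T) (linkB A S') (cellA B lST) (cellV vb) (cellV xiS)
    (cellV xiT)
  = cellV (xi_wreath S T S' lST vb xiS xiT).
Proof. by rewrite /xi_wreath lbarA !link_monadE !linkE. Qed.

Definition link_wreathE := (law_wreathlA, law_wreathlB, law_wreathrA, law_wreathrB,
  wreathA, wreathB, xi_wreathV).

Variables (X : wdl0 A) (Y : wdl0 B) (F : wdl1 X Y).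
Local Notation v := (wv F).
Local Notation vb := (wvb F).
Local Notation xi := (wxi F).
Local Notation s := (ws X).
Local Notation l := (wl X).
Local Notation s' := (ws Y).
Local Notation l' := (wl Y).
Local Notation W i j := (wreath (s j) (s i) (l i j)).
Local Notation W' i j := (wreath (s' j) (s' i) (l' i j)).
Local Notation lwl i j k :=
  (law_wreathl (s i) (s j) (s k) (l i j) (l i k) (l j k)).
Local Notation lwr i j k :=
  (law_wreathr (s i) (s j) (s k) (l i j) (l i k) (l j k)).
Local Notation lwl' i j k :=
  (law_wreathl (s' i) (s' j) (s' k) (l' i j) (l' i k) (l' j k)).
Local Notation lwr' i j k :=
  (law_wreathr (s' i) (s' j) (s' k) (l' i j) (l' i k) (l' j k)).
Local Notation xiw i j :=
  (xi_wreath (s i) (s j) (s' i) (l i j) vb (xi i) (xi j)).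

Lemma is_mnd1_wreath : is_wdl0 1 X -> is_wdl0 1 Y -> is_wdl1 1 F ->
  is_mnd1 (W 0 1) (W' 0 1) v vb (xiw 0 1).
Proof.
move=> XP YP FP; apply/is_mnd1_link.
have := is_mnd1_wreath01 (link_env (n := 1) isT XP YP FP).
by rewrite !linkX_wsE !linkX_wlE !link_wreathE.
Qed.

Hypotheses (XP : is_wdl0 2 X) (YP : is_wdl0 2 Y) (FP : is_wdl1 2 F).

Lemma wdl1_wreathl :
  vcomp (hcomp vb (lwl 0 1 2))
    (vcomp (hcomp (xi 2) (mtb (W 0 1))) (hcomp (mtb (s' 2)) (xiw 0 1)))
  = vcomp (hcomp vb (lbar (s 2) (W 0 1) (lwl 0 1 2)))
      (vcomp (hcomp (xiw 0 1) (mtb (s 2)))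
        (vcomp (hcomp (mtb (W' 0 1)) (xi 2)) (hcomp (lwl' 0 1 2) vb))).
Proof.
have := wdl1_wreath01_2 (link_env (n := 2) isT XP YP FP).
rewrite !linkX_wsE !linkX_wlE !link_wreathE.
by rewrite lbarA !link_monadE !linkE => /cellV_inj.
Qed.

Lemma wdl1_wreathr :
  vcomp (hcomp vb (lwr 0 1 2))
    (vcomp (hcomp (xiw 1 2) (mtb (s 0))) (hcomp (mtb (W' 1 2)) (xi 0)))
  = vcomp (hcomp vb (lbar (W 1 2) (s 0) (lwr 0 1 2)))
      (vcomp (hcomp (xi 0) (mtb (W 1 2)))
        (vcomp (hcomp (mtb (s' 0)) (xiw 1 2)) (hcomp (lwr' 0 1 2) vb))).
Proof.
have := wdl1_0_wreath12 (link_env (n := 2) isT XP YP FP).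
rewrite !linkX_wsE !linkX_wlE !link_wreathE.
by rewrite lbarA !link_monadE !linkE => /cellV_inj.
Qed.

Lemma xi_wreathA :
  xi_wreath (W 0 1) (s 2) (W' 0 1) (lwl 0 1 2) vb (xiw 0 1) (xi 2)
  = xi_wreath (s 0) (W 1 2) (s' 0) (lwr 0 1 2) vb (xi 0) (xiw 1 2).
Proof.
have := xi_wreath012A (link_env (n := 2) isT XP YP FP).
rewrite !linkX_wsE !linkX_wlE !link_wreathE.
by move/cellV_inj.
Qed.

End WreathOneCells.

(** * The 2-functors C_k *)

Section Subfamilies.
Variable K : TwoCat.

(** The diagram lemmas speak of the monads 0, 1, 2, 3. With [f] the function [nth 0] of a sorted
    list they apply to any increasing choice of indices. *)
Definition sub_wdl0 (f : nat -> nat) (A : Obj K) (X : wdl0 A) : wdl0 A :=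
  WDL0 (fun i => ws X (f i)) (fun i j => wl X (f i) (f j)).

Definition sub_wdl1 (f : nat -> nat) (A B : Obj K) (X : wdl0 A) (Y : wdl0 B)
    (F : wdl1 X Y) : wdl1 (sub_wdl0 f X) (sub_wdl0 f Y) :=
  @WDL1 K A B (sub_wdl0 f X) (sub_wdl0 f Y) (wv F) (wvb F) (fun i => wxi F (f i)).

Lemma sub_nth n (m : nat) (s : seq nat) :
  sorted ltn (m :: s) -> all (fun i => i <= n) (m :: s) ->
  (forall i, i <= size s -> nth 0 (m :: s) i <= n) /\
  (forall i j, i < j -> j <= size s -> nth 0 (m :: s) i < nth 0 (m :: s) j).
Proof.
move=> so le_n; split=> [i hi|i j ij hj]; first exact: (all_nthP 0 le_n).
by apply: (sorted_ltn_nth ltn_trans 0 so) => //; rewrite inE /= ltnS // (leq_trans (ltnW ij)).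
Qed.

Lemma is_wdl0_sub n m s (A : Obj K) (X : wdl0 A) : is_wdl0 n X ->
  sorted ltn (m :: s) -> all (fun i => i <= n) (m :: s) ->
  is_wdl0 (size s) (sub_wdl0 (nth 0 (m :: s)) X).
Proof.
move=> [hm hl hy] so le_n; have [bd mono] := sub_nth so le_n.
split=> /= [i hi|i j ij hj|i j k ij jk hk].
- exact/hm/bd.
- by apply: hl; [apply: mono | apply: bd].
by apply: hy; [apply: mono => //; apply: leq_trans (ltnW jk) hk | apply: mono | apply: bd].
Qed.

Lemma is_wdl1_sub n m s (A B : Obj K) (X : wdl0 A) (Y : wdl0 B) (F : wdl1 X Y) :
  is_wdl1 n F -> sorted ltn (m :: s) -> all (fun i => i <= n) (m :: s) ->
  is_wdl1 (size s) (sub_wdl1 (nth 0 (m :: s)) F).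
Proof.
move=> [hv hm hl] so le_n; have [bd mono] := sub_nth so le_n.
split=> //= [i hi|i j ij hj]; first exact/hm/bd.
by apply: hl; [apply: mono | apply: bd].
Qed.

End Subfamilies.

Section Ck.
Variable K : TwoCat.

Section Projections.
Variables (p : nat) (A B : Obj K) (X : wdl0 A) (Y : wdl0 B) (F : wdl1 X Y).
Local Notation C := (Ck0 p.+1 X).
Local Notation s := (ws X).
Local Notation l := (wl X).

Lemma ws_Ck_lt i : i < p -> ws C i = s i.
Proof. by move=> h; rewrite /= h. Qed.
Lemma ws_Ck_eq : ws C p = wreath (s p.+1) (s p) (l p p.+1).
Proof. by rewrite /= ltnn eqxx. Qed.
Lemma ws_Ck_gt i : p < i -> ws C i = s i.+1.
Proof. by move=> h; rewrite /= ltnNge (ltnW h) (gtn_eqF h). Qed.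

Lemma oldi_lt i : i < p -> oldi p.+1 i = i.
Proof. by rewrite /oldi /= => ->. Qed.
Lemma oldi_gt i : p < i -> oldi p.+1 i = i.+1.
Proof. by move=> h; rewrite /oldi /= ltnNge (ltnW h). Qed.

Lemma wl_Ck_eq j : p < j -> wl C p j =
  law_wreathl (s p) (s p.+1) (s j.+1) (l p p.+1) (l p j.+1) (l p.+1 j.+1).
Proof. by move=> h; rewrite /= eqxx oldi_gt. Qed.
Lemma wl_Ck_lt_eq i : i < p -> wl C i p =
  law_wreathr (s i) (s p) (s p.+1) (l i p) (l i p.+1) (l p p.+1).
Proof. by move=> h; rewrite /= eqxx (ltn_eqF h). Qed.
Lemma wl_Ck_lt_lt i j : i < p -> j < p -> wl C i j = l i j.
Proof. by move=> h h'; rewrite /= (ltn_eqF h) (ltn_eqF h') !oldi_lt. Qed.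
Lemma wl_Ck_lt_gt i j : i < p -> p < j -> wl C i j = l i j.+1.
Proof. by move=> h h'; rewrite /= (ltn_eqF h) (gtn_eqF h') oldi_lt // oldi_gt. Qed.
Lemma wl_Ck_gt_gt i j : p < i -> p < j -> wl C i j = l i.+1 j.+1.
Proof. by move=> h h'; rewrite /= (gtn_eqF h) (gtn_eqF h') !oldi_gt. Qed.

Lemma wxi_Ck_lt i : i < p -> wxi (Ck1 p.+1 F) i = wxi F i.
Proof. by move=> h; rewrite /= h. Qed.
Lemma wxi_Ck_eq : wxi (Ck1 p.+1 F) p =
  xi_wreath (s p) (s p.+1) (ws Y p) (l p p.+1) (wvb F) (wxi F p) (wxi F p.+1).
Proof. by rewrite /= ltnn eqxx. Qed.
Lemma wxi_Ck_gt i : p < i -> wxi (Ck1 p.+1 F) i = wxi F i.+1.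
Proof. by move=> h; rewrite /= ltnNge (ltnW h) (gtn_eqF h). Qed.

End Projections.

(** Position [p] holds the product. An axiom that involves it is a wreath lemma for the subfamily in
    which [p] is replaced by [p], [p.+1]; every other axiom is inherited from [X] with shifted
    indices. *)
Lemma is_wdl0_Ck n p (A : Obj K) (X : wdl0 A) : p <= n ->
  is_wdl0 n.+1 X -> is_wdl0 n (Ck0 p.+1 X).
Proof.
move=> pn XP; have [hm hl hy] := XP; split.
- move=> i hi; case: (ltngtP i p) => [h|h|->].
  + by rewrite ws_Ck_lt //; apply/hm/leqW.
  + by rewrite ws_Ck_gt //; apply: hm.
  have so : sorted ltn [:: p; p.+1] by rewrite /= ltnSn.
  have le_n : all (fun i => i <= n.+1) [:: p; p.+1] by rewrite /= ltnS pn leqW.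
  rewrite ws_Ck_eq; exact: (is_bmonad_wreath01 (is_wdl0_sub XP so le_n)).
- move=> i j ij hj; case: (ltngtP i p) => [ip|ip|ip].
  + case: (ltngtP j p) => [h|h|->].
    * by rewrite wl_Ck_lt_lt // !ws_Ck_lt //; apply/hl/leqW.
    * by rewrite wl_Ck_lt_gt // (ws_Ck_lt _ ip) ws_Ck_gt //; apply: hl => //; apply: leqW.
    rewrite wl_Ck_lt_eq // ws_Ck_eq ws_Ck_lt //.
    have so : sorted ltn [:: i; p; p.+1] by rewrite /= ip ltnSn.
    have le_n : all (fun i => i <= n.+1) [:: i; p; p.+1].
      by rewrite /= ltnS pn (leq_trans (ltnW ip)) ?(leqW pn).
    exact: (is_wdl_0_wreath12 (is_wdl0_sub XP so le_n)).
  + have jp := ltn_trans ip ij.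
    by rewrite wl_Ck_gt_gt // !ws_Ck_gt //; apply: hl.
  rewrite ip in ij *; rewrite wl_Ck_eq // ws_Ck_eq ws_Ck_gt //.
  have so : sorted ltn [:: p; p.+1; j.+1] by rewrite /= ltnSn ltnS ij.
  have le_n : all (fun i => i <= n.+1) [:: p; p.+1; j.+1] by rewrite /= !ltnS pn hj leqW.
  exact: (is_wdl_wreath01_2 (is_wdl0_sub XP so le_n)).
move=> i j k ij jk hk; have ik := ltn_trans ij jk.
case: (ltngtP k p) => [kp|pk|kp].
- have [jp ip] := (ltn_trans jk kp, ltn_trans ik kp).
  by rewrite !wl_Ck_lt_lt // !ws_Ck_lt //; apply/hy/leqW.
- case: (ltngtP j p) => [jp|pj|jp].
  + have ip := ltn_trans ij jp.
    rewrite wl_Ck_lt_lt // !wl_Ck_lt_gt // !(ws_Ck_lt _ ip) !(ws_Ck_lt _ jp) !ws_Ck_gt //.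
    by apply: hy => //; apply: leqW.
  + case: (ltngtP i p) => [ip|pi|ip].
    * rewrite !(wl_Ck_lt_gt _ ip) // wl_Ck_gt_gt // !(ws_Ck_lt _ ip) !ws_Ck_gt //.
      by apply: hy => //; apply: leqW.
    * by rewrite !wl_Ck_gt_gt // !ws_Ck_gt //; apply: hy.
    rewrite {}ip in ij ik *; rewrite !wl_Ck_eq // wl_Ck_gt_gt // ws_Ck_eq !ws_Ck_gt //.
    have so : sorted ltn [:: p; p.+1; j.+1; k.+1] by rewrite /= ltnSn !ltnS ij jk.
    have le_n : all (fun i => i <= n.+1) [:: p; p.+1; j.+1; k.+1].
      by rewrite /= !ltnS pn hk (leqW pn) (leq_trans (ltnW jk)).
    exact: (yang_baxter_01_2_3 (is_wdl0_sub XP so le_n)).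
  rewrite {}jp in ij jk *; rewrite !wl_Ck_eq // wl_Ck_lt_eq // wl_Ck_lt_gt //.
  rewrite ws_Ck_eq !(ws_Ck_lt _ ij) !ws_Ck_gt //.
  have so : sorted ltn [:: i; p; p.+1; k.+1] by rewrite /= ij ltnSn ltnS pk.
  have le_n : all (fun i => i <= n.+1) [:: i; p; p.+1; k.+1].
    by rewrite /= !ltnS pn hk (leqW pn) (leq_trans (ltnW ij)) ?(leqW pn).
  exact: (yang_baxter_0_12_3 (is_wdl0_sub XP so le_n)).
rewrite {}kp in jk ik hk *; rewrite !wl_Ck_lt_eq // wl_Ck_lt_lt // ws_Ck_eq !ws_Ck_lt //.
have so : sorted ltn [:: i; j; p; p.+1] by rewrite /= ij jk ltnSn.
have le_n : all (fun i => i <= n.+1) [:: i; j; p; p.+1].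
  by rewrite /= ltnS pn (leqW pn) !(leq_trans (ltnW _) (leqW pn)).
exact: (yang_baxter_0_1_23 (is_wdl0_sub XP so le_n)).
Qed.

Lemma is_wdl1_Ck n p (A B : Obj K) (X : wdl0 A) (Y : wdl0 B) (F : wdl1 X Y) : p <= n ->
  is_wdl0 n.+1 X -> is_wdl0 n.+1 Y -> is_wdl1 n.+1 F -> is_wdl1 n (Ck1 p.+1 F).
Proof.
move=> pn XP YP FP; have [hv hm hl] := FP; split=> //.
- move=> i hi; case: (ltngtP i p) => [h|h|->].
  + by rewrite wxi_Ck_lt // !ws_Ck_lt //; apply/hm/leqW.
  + by rewrite wxi_Ck_gt // !ws_Ck_gt //; apply: hm.
  rewrite wxi_Ck_eq !ws_Ck_eq.
  have so : sorted ltn [:: p; p.+1] by rewrite /= ltnSn.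
  have le_n : all (fun i => i <= n.+1) [:: p; p.+1] by rewrite /= ltnS pn leqW.
  exact: (is_mnd1_wreath (F := sub_wdl1 (nth 0 [:: p; p.+1]) F)
    (is_wdl0_sub XP so le_n) (is_wdl0_sub YP so le_n) (is_wdl1_sub FP so le_n)).
move=> i j ij hj; case: (ltngtP i p) => [ip|ip|ip].
- case: (ltngtP j p) => [h|h|jp].
  + by rewrite !wxi_Ck_lt // !wl_Ck_lt_lt // !ws_Ck_lt //; apply/hl/leqW.
  + rewrite (wxi_Ck_lt _ ip) wxi_Ck_gt // !wl_Ck_lt_gt // !(ws_Ck_lt _ ip) !ws_Ck_gt //.
    by apply: hl => //; apply: leqW.
  rewrite {}jp in ij hj *; rewrite wxi_Ck_eq wxi_Ck_lt // !wl_Ck_lt_eq // !ws_Ck_eq !ws_Ck_lt //.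
  have so : sorted ltn [:: i; p; p.+1] by rewrite /= ip ltnSn.
  have le_n : all (fun i => i <= n.+1) [:: i; p; p.+1].
    by rewrite /= ltnS pn (leq_trans (ltnW ip)) ?(leqW pn).
  exact: (wdl1_wreathr (F := sub_wdl1 (nth 0 [:: i; p; p.+1]) F)
    (is_wdl0_sub XP so le_n) (is_wdl0_sub YP so le_n) (is_wdl1_sub FP so le_n)).
- have jp := ltn_trans ip ij.
  by rewrite !wxi_Ck_gt // !wl_Ck_gt_gt // !ws_Ck_gt //; apply: hl.
rewrite {}ip in ij *; rewrite wxi_Ck_eq wxi_Ck_gt // !wl_Ck_eq // !ws_Ck_eq !ws_Ck_gt //.
have so : sorted ltn [:: p; p.+1; j.+1] by rewrite /= ltnSn ltnS ij.
have le_n : all (fun i => i <= n.+1) [:: p; p.+1; j.+1] by rewrite /= !ltnS pn hj leqW.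
exact: (wdl1_wreathl (F := sub_wdl1 (nth 0 [:: p; p.+1; j.+1]) F)
  (is_wdl0_sub XP so le_n) (is_wdl0_sub YP so le_n) (is_wdl1_sub FP so le_n)).
Qed.

(* Only the monads of index at most n, and the laws between them, matter. *)
Definition wdl0_eq n (A : Obj K) (X Y : wdl0 A) :=
  (forall i, i <= n -> ws X i = ws Y i) /\
  (forall i j, i < j -> j <= n -> wl X i j = wl Y i j).

(** [F] and [F'] have different types when their 0-cells differ, so the comparison is by components
    and includes the 0-cells. *)
Definition wdl1_eq n (A B : Obj K) (X X' : wdl0 A) (Y Y' : wdl0 B)
    (F : wdl1 X Y) (F' : wdl1 X' Y') :=
  [/\ wdl0_eq n X X', wdl0_eq n Y Y', wv F = wv F', wvb F = wvb F' &
      forall i, i <= n -> wxi F i = wxi F' i].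

Lemma Ck0_eq n p (A : Obj K) (X Y : wdl0 A) : p <= n ->
  wdl0_eq n.+1 X Y -> wdl0_eq n (Ck0 p.+1 X) (Ck0 p.+1 Y).
Proof.
move=> pn [es el]; have sp := es p (leqW pn); have sp' := es p.+1 pn.
have lp := el p p.+1 (ltnSn p) pn.
split=> [i hi|i j ij hj].
  case: (ltngtP i p) => [h|h|->]; first by rewrite !ws_Ck_lt //; apply/es/leqW.
    by rewrite !ws_Ck_gt //; apply: es.
  by rewrite !ws_Ck_eq sp sp' lp.
have hi := leq_trans (ltnW ij) hj.
case: (ltngtP i p) => [ip|ip|ip].
- case: (ltngtP j p) => [h|h|->].
  + by rewrite !wl_Ck_lt_lt //; apply/el/leqW.
  + by rewrite !wl_Ck_lt_gt //; apply/el => //; apply: leqW.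
  by rewrite !wl_Ck_lt_eq // sp sp' lp es ?(leqW hi) // !el // ?leqW.
- by rewrite !wl_Ck_gt_gt //; [apply: el | apply: ltn_trans ij..].
rewrite {}ip in ij *.
by rewrite !wl_Ck_eq // sp sp' lp es // !el // leqW.
Qed.

Lemma Ck1_eq n p (A B : Obj K) (X X' : wdl0 A) (Y Y' : wdl0 B) (F : wdl1 X Y)
    (F' : wdl1 X' Y') : p <= n ->
  wdl1_eq n.+1 F F' -> wdl1_eq n (Ck1 p.+1 F) (Ck1 p.+1 F').
Proof.
move=> pn [eX eY ev evb exi]; split=> //; try exact: Ck0_eq.
case: eX eY => [es el] [es' _] i hi.
case: (ltngtP i p) => [h|h|->]; first by rewrite !wxi_Ck_lt //; apply/exi/leqW.
  by rewrite !wxi_Ck_gt //; apply: exi.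
by rewrite !wxi_Ck_eq !es ?es' ?exi ?el ?evb // leqW.
Qed.

(** * Iterated composites and their independence of the indices *)

Definition indices n (ks : nat -> nat) :=
  forall i, 1 <= i -> i <= n -> 1 <= ks i /\ ks i <= i.

Lemma Ccomp0_eq n ks ks' (A : Obj K) (X Y : wdl0 A) : indices n ks ->
  (forall i, 1 <= i -> i <= n -> ks i = ks' i) -> wdl0_eq n X Y ->
  ws (Ccomp0 ks n X) 0 = ws (Ccomp0 ks' n Y) 0.
Proof.
elim: n X Y => [|n IH] X Y kP kE /= XY; first by case: XY => ->.
have [] := kP n.+1 isT (leqnn _); rewrite -kE //; case: (ks _) => // p _ pn.
apply: IH; last exact: Ck0_eq.
  by move=> i h h'; apply: kP => //; apply: leqW.
by move=> i h h'; apply: kE => //; apply: leqW.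
Qed.

Lemma Ccomp1_eq n ks ks' (A B : Obj K) (X X' : wdl0 A) (Y Y' : wdl0 B)
    (F : wdl1 X Y) (F' : wdl1 X' Y') : indices n ks ->
  (forall i, 1 <= i -> i <= n -> ks i = ks' i) -> wdl1_eq n F F' ->
  (wv (Ccomp1 ks n F), wvb (Ccomp1 ks n F), wxi (Ccomp1 ks n F) 0)
  = (wv (Ccomp1 ks' n F'), wvb (Ccomp1 ks' n F'), wxi (Ccomp1 ks' n F') 0).
Proof.
elim: n X X' Y Y' F F' => [|n IH] X X' Y Y' F F' kP kE /= FF'.
  by case: FF' => _ _ -> -> ->.
have [] := kP n.+1 isT (leqnn _); rewrite -kE //; case: (ks _) => // p _ pn.
apply: IH; last exact: Ck1_eq.
  by move=> i h h'; apply: kP => //; apply: leqW.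
by move=> i h h'; apply: kE => //; apply: leqW.
Qed.

Lemma C1C2_0 n (A : Obj K) (X : wdl0 A) : is_wdl0 n.+2 X ->
  wdl0_eq n (Ck0 1 (Ck0 2 X)) (Ck0 1 (Ck0 1 X)).
Proof.
(* All components agree by computation except the monad 0 and its laws with later monads. *)
move=> XP; split=> [[|i] hi|[|i] [|j] // ij hj] //.
  have h := is_wdl0_sub (s := [:: 1; 2]) (m := 0) XP isT isT.
  exact: (esym (wreath012A h)).
have le_n : all (fun i => i <= n.+2) [:: 0; 1; 2; j.+3] by rewrite /= !ltnS hj.
have so : sorted ltn [:: 0; 1; 2; j.+3] by [].
exact: (esym (law_wreath012_3 (is_wdl0_sub XP so le_n))).
Qed.

Lemma C1C2_1 n (A B : Obj K) (X : wdl0 A) (Y : wdl0 B) (F : wdl1 X Y) :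
  is_wdl0 n.+2 X -> is_wdl0 n.+2 Y -> is_wdl1 n.+2 F ->
  wdl1_eq n (Ck1 1 (Ck1 2 F)) (Ck1 1 (Ck1 1 F)).
Proof.
move=> XP YP FP; split=> //; try exact: C1C2_0.
case=> // _; have so : sorted ltn [:: 0; 1; 2] by [].
have le_n : all (fun i => i <= n.+2) [:: 0; 1; 2] by [].
exact: (esym (xi_wreathA (F := sub_wdl1 (nth 0 [:: 0; 1; 2]) F)
  (is_wdl0_sub XP so le_n) (is_wdl0_sub YP so le_n) (is_wdl1_sub FP so le_n))).
Qed.

(** Merging 0 and 1 first moves the other product one place down, whence [p.+2] on the right.
    Unfolding settles every component except the law between the two products. *)
Lemma C1Ck_0 n p (A : Obj K) (X : wdl0 A) : p <= n -> is_wdl0 n.+3 X ->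
  wdl0_eq n.+1 (Ck0 1 (Ck0 p.+3 X)) (Ck0 p.+2 (Ck0 1 X)).
Proof.
move=> pn XP; split=> [[|i] hi|[|i] [|j] // ij hj] //.
  case: (ltngtP j p) => [h|h|->].
  - rewrite [RHS]wl_Ck_lt_lt // [LHS](wl_Ck_eq (p := 0)) //.
    by rewrite !(wl_Ck_lt_lt (p := p.+2)) // !(ws_Ck_lt (p := p.+2)).
  - rewrite [RHS]wl_Ck_lt_gt // [LHS](wl_Ck_eq (p := 0)) //.
    rewrite (wl_Ck_lt_lt (p := p.+2)) // !(wl_Ck_lt_gt (p := p.+2)) //.
    by rewrite (ws_Ck_gt X (h : p.+2 < j.+2)) !(ws_Ck_lt (p := p.+2)).
  rewrite [RHS]wl_Ck_lt_eq // [LHS](wl_Ck_eq (p := 0)) //.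
  rewrite (wl_Ck_lt_lt (p := p.+2)) // !(wl_Ck_lt_eq (p := p.+2)) //.
  rewrite (ws_Ck_eq p.+2) !(ws_Ck_lt (p := p.+2)) //.
  have so : sorted ltn [:: 0; 1; p.+2; p.+3] by rewrite /= !ltnS leqnn.
  have le_n : all (fun i => i <= n.+3) [:: 0; 1; p.+2; p.+3].
    by rewrite /= !ltnS pn leqW.
  exact: (law_wreath01_23 (is_wdl0_sub XP so le_n)).
rewrite [LHS](wl_Ck_gt_gt (p := 0)) //.
case: (ltngtP i p) => [ip|ip|ip].
- case: (ltngtP j p) => [h|h|->].
  + by rewrite [LHS]wl_Ck_lt_lt // [RHS]wl_Ck_lt_lt.
  + by rewrite [LHS]wl_Ck_lt_gt // [RHS]wl_Ck_lt_gt.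
  by rewrite [LHS]wl_Ck_lt_eq // [RHS]wl_Ck_lt_eq.
- by have jp := ltn_trans ip ij; rewrite [LHS]wl_Ck_gt_gt // [RHS]wl_Ck_gt_gt.
by rewrite {}ip in ij *; rewrite [LHS]wl_Ck_eq // [RHS]wl_Ck_eq.
Qed.

Lemma C1Ck_1 n p (A B : Obj K) (X : wdl0 A) (Y : wdl0 B) (F : wdl1 X Y) :
  p <= n -> is_wdl0 n.+3 X -> is_wdl0 n.+3 Y ->
  wdl1_eq n.+1 (Ck1 1 (Ck1 p.+3 F)) (Ck1 p.+2 (Ck1 1 F)).
Proof.
move=> pn XP YP; split=> //; try exact: C1Ck_0.
by case.
Qed.

(** The induction is over all [ks], since the hypothesis serves twice: it replaces the indices below
    the top one by 1, and it disposes of the sequence [k] introduced below. *)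
Lemma Ccomp0_ones n ks (A : Obj K) (X : wdl0 A) : indices n ks -> is_wdl0 n X ->
  ws (Ccomp0 ks n X) 0 = ws (Ccomp0 (fun=> 1) n X) 0.
Proof.
elim/ltn_ind: n ks X => -[|[|n]] IH ks X kP XP //=.
  by have [] := kP 1 isT isT; case: (ks 1) => [|[]].
have [] := kP n.+2 isT (leqnn _); case: (ks n.+2) => // p _ pn.
have kP' : indices n.+1 ks by move=> i h h'; apply: kP => //; apply: leqW.
rewrite -[LHS]/(ws (Ccomp0 ks n.+1 (Ck0 p.+1 X)) 0) IH //; last exact: is_wdl0_Ck.
case: p pn => [|[|p]] // pn.
  by apply: (@Ccomp0_eq n) => //; apply: C1C2_0.
case: n => [|n] in IH kP XP kP' pn *; first by [].
(* After [C_1 C_{p+3} = C_{p+2} C_1], the composite applied to [Ck0 1 X] has top index [p.+2] and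
   all others 1; [k] is that sequence, and the induction hypothesis turns it into ones. *)
pose k i := if i == n.+2 then p.+2 else 1.
have kE : k n.+2 = p.+2 by rewrite /k eqxx.
have kk : indices n.+2 k by move=> i h h'; rewrite /k; case: eqP => [->|].
transitivity (ws (Ccomp0 k n.+2 (Ck0 1 X)) 0); last first.
  by rewrite IH //; apply: is_wdl0_Ck.
rewrite -[RHS]/(ws (Ccomp0 k n.+1 (Ck0 (k n.+2) (Ck0 1 X))) 0) kE.
apply: (@Ccomp0_eq n.+1) => //; last exact: C1Ck_0.
by move=> i _ hi; rewrite /k ltn_eqF.
Qed.

(** Different index sequences give 1-cells of different dependent types; the triple of data makes an
    equation between them expressible. *)
Definition mnd1_data (A B : Obj K) (X : wdl0 A) (Y : wdl0 B) (F : wdl1 X Y) :=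
  (wv F, wvb F, wxi F 0).

Lemma Ccomp1_ones n ks (A B : Obj K) (X : wdl0 A) (Y : wdl0 B) (F : wdl1 X Y) :
  indices n ks -> is_wdl0 n X -> is_wdl0 n Y -> is_wdl1 n F ->
  mnd1_data (Ccomp1 ks n F) = mnd1_data (Ccomp1 (fun=> 1) n F).
Proof.
elim/ltn_ind: n ks X Y F => -[|[|n]] IH ks X Y F kP XP YP FP //=.
  by have [] := kP 1 isT isT; case: (ks 1) => [|[]].
have [] := kP n.+2 isT (leqnn _); case: (ks n.+2) => // p _ pn.
have kP' : indices n.+1 ks by move=> i h h'; apply: kP => //; apply: leqW.
have XC q : q <= n.+1 -> is_wdl0 n.+1 (Ck0 q.+1 X) by move=> h; apply: is_wdl0_Ck.
have YC q : q <= n.+1 -> is_wdl0 n.+1 (Ck0 q.+1 Y) by move=> h; apply: is_wdl0_Ck.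
have FC q : q <= n.+1 -> is_wdl1 n.+1 (Ck1 q.+1 F) by move=> h; apply: is_wdl1_Ck.
rewrite -[LHS]/(mnd1_data (Ccomp1 ks n.+1 (Ck1 p.+1 F))) IH; auto.
case: p pn => [|[|p]] // pn.
  by apply: (@Ccomp1_eq n) => //; apply: C1C2_1.
case: n => [|n] in IH kP XP YP FP kP' XC YC FC pn *; first by [].
pose k i := if i == n.+2 then p.+2 else 1.
have kE : k n.+2 = p.+2 by rewrite /k eqxx.
have kk : indices n.+2 k by move=> i h h'; rewrite /k; case: eqP => [->|].
transitivity (mnd1_data (Ccomp1 k n.+2 (Ck1 1 F))); last by rewrite IH; auto.
rewrite -[RHS]/(mnd1_data (Ccomp1 k n.+1 (Ck1 (k n.+2) (Ck1 1 F)))) kE.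
apply: (@Ccomp1_eq n.+1) => //; last exact: C1Ck_1.
by move=> i _ hi; rewrite /k ltn_eqF.
Qed.
End Ck.

Theorem theorem2p10 (K : TwoCat) (n : nat) (n_gt0 : 0 < n)
  (ks ks' : nat -> nat)
  (hks : forall i, 1 <= i -> i <= n -> 1 <= ks i /\ ks i <= i)
  (hks' : forall i, 1 <= i -> i <= n -> 1 <= ks' i /\ ks' i <= i) :
  (forall (A : Obj K) (X : wdl0 A), is_wdl0 n X ->
     ws (Ccomp0 ks n X) 0 = ws (Ccomp0 ks' n X) 0) /\
  (forall (A B : Obj K) (X : wdl0 A) (Y : wdl0 B) (F : wdl1 X Y),
     is_wdl0 n X -> is_wdl0 n Y -> is_wdl1 n F ->
     (wv (Ccomp1 ks n F), wvb (Ccomp1 ks n F), wxi (Ccomp1 ks n F) 0)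
     = (wv (Ccomp1 ks' n F), wvb (Ccomp1 ks' n F), wxi (Ccomp1 ks' n F) 0)).
Proof.
split=> [A X XP|A B X Y F XP YP FP].
  by rewrite (Ccomp0_ones hks XP) (Ccomp0_ones hks' XP).
exact: etrans (Ccomp1_ones hks XP YP FP) (esym (Ccomp1_ones hks' XP YP FP)).
Qed.
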